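(* Let $\theta\geq 0$, $a\geq 0$, $b\geq 0$ with $ab<1$, and put $c=b(1-ab)^{-1}$. Then for every $\varphi\in\mathcal{L}^+_a$ and $f\in\mathcal{L}^+_b$ the function $\varphi(\Delta_\theta)f$ belongs to $\mathcal{L}^+_c$, and the map $(\varphi,f)\mapsto\varphi(\Delta_\theta)f$ is continuous from $\mathcal{L}^+_a\times\mathcal{L}^+_b$ (with the topology induced from $\mathcal{A}_a\times\mathcal{A}_b$) into $\mathcal{L}^+_c$ (with the topology induced from $\mathcal{A}_c$).
   Context: Let $\mathcal{E}$ be the set of entire functions. For $b>0$, $\|f\|_b=\sup_{k\in\mathbb{N}_0}b^{-k}|f^{(k)}(0)|$; for $a\geq0$, $\mathcal{A}_a=\{f\in\mathcal{E}:\|f\|_b<\infty\ \forall b>a\}$ with the locally convex topology generated by $\{\|\cdot\|_b: b>a\}$. $\mathcal{L}^+$ is the set of entire functions $f(z)=Cz^l e^{\alpha z}\prod_{j\ge1}(1+\beta_j z)$ with $C\in\mathbb{C}$, $l\in\mathbb{N}_0$, $\alpha\ge0$, $\beta_j\ge\beta_{j+1}\ge0$, $\sum_j\beta_j<\infty$; $\mathcal{L}^+_a=\mathcal{L}^+\cap\mathcal{A}_a$. For $\theta\ge0$, $\Delta_\theta$ is the differential operator $(\Delta_\theta f)(z)=\theta f'(z)+zf''(z)$. For entire $\varphi,f$, $\varphi(\Delta_\theta)f$ is the function $\sum_{k=0}^\infty\sum_{m=0}^\infty \frac{\varphi^{(k)}(0)}{k!}\frac{f^{(m)}(0)}{m!}\Delta_\theta^k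 z^m$ (note $\Delta_\theta^k z^m$ is a constant multiple of $z^{m-k}$ for $k\le m$ and $0$ for $k>m$). *)

(* Defs.v *)
From Stdlib Require Import Reals Factorial.
From Coquelicot Require Import Coquelicot.
Open Scope R_scope.

(* An entire function is represented by its Taylor coefficient sequence
   u : nat -> C at 0, i.e. f(z) = sum_k u k * z^k, convergent for every z. *)
Definition coefs := nat -> C.

Definition entire (u : coefs) : Prop :=
  forall z : C, ex_series (fun k => Cmult (u k) (Cpow z k)).

Definition deriv0 (u : coefs) (k : nat) : C := Cmult (RtoC (INR (fact k))) (u k).

Definition normb (b : R) (u : coefs) : Rbar :=
  Lub_Rbar (fun r => exists k : nat, r = / (b ^ k) * Cmod (deriv0 u k)).

Definition in_A (a : R) (u : coefs) : Prop :=
  entire u /\ forall b : R, a < b -> is_finite (normb b u).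

Fixpoint partial_prod (beta : nat -> R) (z : C) (n : nat) : C :=
  match n with
  | O => RtoC 1
  | S n' => Cmult (partial_prod beta z n') (Cplus (RtoC 1) (Cmult (RtoC (beta n')) z))
  end.

(* Laguerre–Pólya type class L^+ :
   f(z) = C z^l e^{alpha z} prod_{j>=1} (1 + beta_j z), with alpha >= 0,
   beta_j >= beta_{j+1} >= 0, sum beta_j < oo (indices shifted to start at 0).
   e^{alpha z} is the sum of its exponential series, the product is the limit
   of the partial products. *)
Definition in_Lplus (u : coefs) : Prop :=
  entire u /\
  exists (c0 : C) (l : nat) (alpha : R) (beta : nat -> R),
    0 <= alpha /\
    (forall j, 0 <= beta (S j) <= beta j) /\
    (forall j, 0 <= beta j) /\
    ex_series beta /\
    forall z : C, exists (E P : C),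
      is_series (fun k => Cmult (Cpow (Cmult (RtoC alpha) z) k) (RtoC (/ INR (fact k)))) E /\
      filterlim (partial_prod beta z) eventually (locally P) /\
      is_series (fun k => Cmult (u k) (Cpow z k))
                (Cmult (Cmult (Cmult c0 (Cpow z l)) E) P).

Definition in_Lplus_a (a : R) (u : coefs) : Prop := in_Lplus u /\ in_A a u.

(* Delta_theta^k z^m = dcoef theta k m * z^(m-k)   (0 when k > m),
   where Delta_theta z^m = m (m - 1 + theta) z^(m-1). *)
Fixpoint dcoef (theta : R) (k m : nat) : R :=
  match k with
  | O => 1
  | S k' => dcoef theta k' m * INR (m - k') * (INR (m - k') - 1 + theta)
  end.

Definition CSeries (v : nat -> C) : C :=
  (Series (fun k => fst (v k)), Series (fun k => snd (v k))).

(* The term of the double series contributing to the coefficient of z^n: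
   (phi^{(k)}(0)/k!) (f^{(n+k)}(0)/(n+k)!) * dcoef theta k (n+k). *)
Definition Dop_term (theta : R) (phi f : coefs) (n k : nat) : C :=
  Cmult (Cmult (phi k) (f (n + k)%nat)) (RtoC (dcoef theta k (n + k))).

Definition Dop (theta : R) (phi f : coefs) : coefs :=
  fun n => CSeries (Dop_term theta phi f n).

Definition csub (u v : coefs) : coefs := fun k => Cminus (u k) (v k).

(* Main.v *)
(* Continuity and the growth bound come from an explicit estimate: since
   Delta^k z^(n+k) = (n+k)!/n! (n+theta)_k z^n, the negative binomial series gives
   ||phi(Delta) f||_b3 <= (1 - b1 b2)^(-m) ||phi||_b1 ||f||_b2 as soon as
   b2/(1 - b1 b2) <= b3 and m >= theta is an integer.

   For membership in L^+, approximate phi and f from below, coefficient by coefficient, by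
   c z^l (1 + alpha z/n)^n prod_(j<n) (1 + beta_j z). If g has only nonpositive zeros, so
   has p g + q Delta g (p, q >= 0): for z = w^2 off (-oo, 0] with Re w > 0, put
   r_j = w/(w^2 + x_j), where -x_j are the zeros of g. All r_j lie in the right half plane,
   hence so do their sum P and the "parallel sums" r_j (P - r_j)/P, and
     (p g + q Delta g)(z) / (P g(z)) = p/P + q (theta/w + sum_j r_j (P - r_j)/P).
   So the approximants of phi(Delta) f have only nonpositive zeros, and a coefficientwise
   limit of normalized products prod_j (1 + b_(n,j) z) is e^(alpha z) prod_j (1 + beta_j z):
   extract b_(n,j) -> beta_j for all j; the coefficients of the product beyond j = J differ
   from those of the exponential of its sum by O(1/J), and alpha is the part of
   sum_j b_(n,j) that escapes to infinity. *)

Require Import Defs.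
From mathcomp Require all_boot all_order all_algebra complex Rstruct ring.
From Stdlib Require Import Reals Factorial Wf_nat Lra Lia.
From Stdlib Require Import Classical IndefiniteDescription FunctionalExtensionality.
From Coquelicot Require Import Coquelicot.
Open Scope R_scope.

(** * Coefficient sequences *)

(* A power series stands for its coefficient sequence: [shift] multiplies by [z],
   [mul_linear p q] by [p + q z], and [mul_prod beta n] by [prod_(j < n) (1 + beta j z)]. *)
Definition one_coef (k : nat) : R := match k with O => 1 | S _ => 0 end.

Definition shift (h : nat -> R) (k : nat) : R := match k with O => 0 | S j => h j end.

Definition mul_linear (p q : R) (h : nat -> R) (k : nat) : R := p * h k + q * shift h k.

Fixpoint mul_prod (beta : nat -> R) (n : nat) (h : nat -> R) : nat -> R :=
  match n with O => h | S j => mul_prod beta j (mul_linear 1 (beta j) h) end.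

Lemma shift_ge0 h k : (forall i, 0 <= h i) -> 0 <= shift h k.
Proof. intros h_ge0; destruct k; simpl; [lra|auto]. Qed.

Lemma shift_le h g k : (forall i, h i <= g i) -> shift h k <= shift g k.
Proof. intros hg; destruct k; simpl; [lra|auto]. Qed.

Lemma iter_shift_lt h l k : (k < l)%nat -> Nat.iter l shift h k = 0.
Proof.
revert k; induction l as [|l IHl]; intros [|k] k_l; simpl; [lia|lia|easy|].
apply IHl; lia.
Qed.

Lemma iter_shift_add h l k : Nat.iter l shift h (l + k)%nat = h k.
Proof. induction l; simpl; auto. Qed.

Lemma mul_linear_ge0 p q h k :
  0 <= p -> 0 <= q -> (forall i, 0 <= h i) -> 0 <= mul_linear p q h k.
Proof.
intros p_ge0 q_ge0 h_ge0; apply Rplus_le_le_0_compat; apply Rmult_le_pos; auto.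
now apply shift_ge0.
Qed.

Lemma mul_linear_le p q h g k :
  0 <= p -> 0 <= q -> (forall i, h i <= g i) -> mul_linear p q h k <= mul_linear p q g k.
Proof.
intros p_ge0 q_ge0 hg; apply Rplus_le_compat; apply Rmult_le_compat_l; auto.
now apply shift_le.
Qed.

Lemma mul_linear_shift p q h : mul_linear p q (shift h) = shift (mul_linear p q h).
Proof. apply functional_extensionality; intros [|k]; unfold mul_linear; simpl; ring. Qed.

Lemma mul_linear_comb p q a b g h :
  mul_linear p q (fun k => a * g k + b * h k) =
  (fun k => a * mul_linear p q g k + b * mul_linear p q h k).
Proof. apply functional_extensionality; intros [|k]; unfold mul_linear; simpl; ring. Qed.

Lemma mul_prod_shift beta n h : mul_prod beta n (shift h) = shift (mul_prod beta n h).
Proof. revert h; induction n; intros h; simpl; [easy|]; now rewrite mul_linear_shift. Qed.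

Lemma mul_prod_comb beta n a b g h :
  mul_prod beta n (fun k => a * g k + b * h k) =
  (fun k => a * mul_prod beta n g k + b * mul_prod beta n h k).
Proof.
revert g h; induction n as [|n IHn]; intros g h; simpl; [easy|].
now rewrite mul_linear_comb, IHn.
Qed.

Lemma mul_prod_add beta m n h :
  mul_prod beta (m + n) h = mul_prod beta m (mul_prod (fun j => beta (m + j)%nat) n h).
Proof.
revert h; induction n as [|n IHn]; intros h; simpl; [now rewrite Nat.add_0_r|].
rewrite Nat.add_succ_r; simpl; apply IHn.
Qed.

Lemma mul_prod_ext beta gamma n h :
  (forall j, (j < n)%nat -> beta j = gamma j) -> mul_prod beta n h = mul_prod gamma n h.
Proof.
revert h; induction n as [|n IHn]; intros h eq_beta; simpl; [easy|].
rewrite (eq_beta n) by lia; apply IHn; intros j j_n; apply eq_beta; lia.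
Qed.

Lemma mul_prod_zeros n h : mul_prod (fun _ => 0) n h = h.
Proof.
revert h; induction n as [|n IHn]; intros h; simpl; [easy|]; rewrite IHn.
apply functional_extensionality; intros k; unfold mul_linear; ring.
Qed.

Lemma mul_prod_zero_tail beta N n h : (forall j, (N <= j)%nat -> beta j = 0) ->
  mul_prod beta (N + n) h = mul_prod beta N h.
Proof.
intros zero_tail; rewrite mul_prod_add.
rewrite (mul_prod_ext (fun j => beta (N + j)%nat) (fun _ => 0)), mul_prod_zeros; [easy|].
intros j _; apply zero_tail; lia.
Qed.

Lemma mul_prod_continuous (B h : nat -> nat -> R) (beta g : nat -> R) m :
  (forall j, is_lim_seq (fun n => B n j) (beta j)) ->
  (forall k, is_lim_seq (fun n => h n k) (g k)) ->
  forall k, is_lim_seq (fun n => mul_prod (B n) m (h n) k) (mul_prod beta m g k).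
Proof.
intros B_beta; revert h g; induction m as [|m IHm]; intros h g h_g; simpl; [easy|].
apply IHm; intros k; apply is_lim_seq_plus'; apply is_lim_seq_mult'; auto.
- apply is_lim_seq_const.
- destruct k; simpl; [apply is_lim_seq_const|auto].
Qed.

Fixpoint partial_sum (beta : nat -> R) (n : nat) : R :=
  match n with O => 0 | S j => partial_sum beta j + beta j end.

Lemma partial_sum_add beta m n :
  partial_sum beta (m + n) = partial_sum beta m + partial_sum (fun j => beta (m + j)%nat) n.
Proof.
induction n as [|n IHn]; simpl; [rewrite Nat.add_0_r; ring|].
rewrite Nat.add_succ_r; simpl; rewrite IHn; ring.
Qed.

Lemma partial_sum_const c n : partial_sum (fun _ => c) n = INR n * c.
Proof.
induction n as [|n IHn]; [simpl; ring|]; rewrite S_INR; simpl; rewrite IHn; ring.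
Qed.

Lemma partial_sum_zero_tail beta N n : (forall j, (N <= j)%nat -> beta j = 0) ->
  partial_sum beta (N + n) = partial_sum beta N.
Proof.
intros zero_tail; rewrite partial_sum_add; induction n as [|n IHn]; simpl; [ring|].
rewrite (zero_tail (N + n)%nat) by lia; lra.
Qed.

Lemma sum_n_S (a : nat -> R) n : sum_n a (S n) = sum_n a n + a (S n).
Proof. exact (sum_Sn a n). Qed.

Lemma partial_sum_S beta n : partial_sum beta (S n) = sum_n beta n.
Proof.
induction n as [|n IHn]; [simpl; rewrite sum_O; ring|].
now rewrite sum_n_S, <- IHn.
Qed.

Lemma partial_sum_continuous (B : nat -> nat -> R) (beta : nat -> R) m :
  (forall j, is_lim_seq (fun n => B n j) (beta j)) ->
  is_lim_seq (fun n => partial_sum (B n) m) (partial_sum beta m).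
Proof.
intros B_beta; induction m; simpl; [apply is_lim_seq_const|now apply is_lim_seq_plus'].
Qed.

Lemma mul_prod_0 beta n h : mul_prod beta n h 0 = h 0%nat.
Proof.
revert h; induction n as [|n IHn]; intros h; simpl; [easy|]; rewrite IHn.
unfold mul_linear; simpl; ring.
Qed.

Lemma mul_prod_1 beta n h : mul_prod beta n h 1 = h 1%nat + partial_sum beta n * h 0%nat.
Proof.
revert h; induction n as [|n IHn]; intros h; simpl; [ring|]; rewrite IHn.
unfold mul_linear; simpl; ring.
Qed.

Section NonnegativeFactors.

Variable beta : nat -> R.
Hypothesis beta_ge0 : forall j, 0 <= beta j.

Lemma partial_sum_ge0 n : 0 <= partial_sum beta n.
Proof. induction n; simpl; [lra|]; specialize (beta_ge0 n); lra. Qed.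

Lemma mul_prod_ge0 n h k : (forall i, 0 <= h i) -> 0 <= mul_prod beta n h k.
Proof.
revert h; induction n as [|n IHn]; intros h h_ge0; simpl; [auto|].
apply IHn; intros i; apply mul_linear_ge0; auto; lra.
Qed.

Lemma mul_prod_le n h g k :
  (forall i, h i <= g i) -> mul_prod beta n h k <= mul_prod beta n g k.
Proof.
revert h g; induction n as [|n IHn]; intros h g hg; simpl; [auto|].
apply IHn; intros i; apply mul_linear_le; auto; lra.
Qed.

Lemma mul_prod_le_S n h k :
  (forall i, 0 <= h i) -> mul_prod beta n h k <= mul_prod beta (S n) h k.
Proof.
intros h_ge0; simpl; apply mul_prod_le; intros i; unfold mul_linear.
assert (shift_h := Rmult_le_pos _ _ (beta_ge0 n) (shift_ge0 h i h_ge0)); lra.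
Qed.

End NonnegativeFactors.

Definition nonneg_antitone (beta : nat -> R) : Prop := forall j, 0 <= beta (S j) <= beta j.

Lemma nonneg_antitone_ge0 beta : nonneg_antitone beta -> forall j, 0 <= beta j.
Proof. intros beta_na j; destruct (beta_na j); lra. Qed.

Lemma antitone_tail_le beta m j : nonneg_antitone beta -> beta (m + j)%nat <= beta m.
Proof.
intros beta_na; induction j as [|j IHj]; [rewrite Nat.add_0_r; lra|].
rewrite Nat.add_succ_r; destruct (beta_na (m + j)%nat); lra.
Qed.

Lemma antitone_le_partial_sum beta n :
  nonneg_antitone beta -> INR n * beta n <= partial_sum beta n.
Proof.
intros beta_na; induction n as [|n IHn]; [simpl; lra|].
rewrite S_INR; simpl partial_sum; specialize (beta_na n); assert (n_ge0 := pos_INR n); nra.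
Qed.

Lemma partial_sum_sqr_le beta n M : (forall j, 0 <= beta j <= M) ->
  partial_sum (fun j => beta j ^ 2) n <= M * partial_sum beta n.
Proof.
intros bounds; induction n as [|n IHn]; simpl in *; [lra|]; specialize (bounds n); nra.
Qed.

(* The terms beyond the [m]-th are at most [s / m] and add up to at most [s], where [s] is
   the full sum. *)
Lemma tail_sum_sqr_le beta m n : nonneg_antitone beta ->
  INR m * partial_sum (fun j => beta (m + j)%nat ^ 2) n <= partial_sum beta (m + n) ^ 2.
Proof.
intros beta_na; assert (beta_ge0 := nonneg_antitone_ge0 beta beta_na).
set (tail := fun j => beta (m + j)%nat).
assert (head_ge0 := partial_sum_ge0 beta beta_ge0 m).
assert (tail_ge0 : 0 <= partial_sum tail n) by (apply partial_sum_ge0; intros j; apply beta_ge0).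
assert (head_le := antitone_le_partial_sum beta m beta_na).
assert (sqr_le := partial_sum_sqr_le tail n (beta m)
  (fun j => conj (beta_ge0 _) (antitone_tail_le beta m j beta_na))).
apply (Rmult_le_compat_l (INR m)) in sqr_le; [|apply pos_INR].
apply (Rmult_le_compat_r (partial_sum tail n)) in head_le; [|easy].
rewrite partial_sum_add; fold tail.
change (fun j => tail j ^ 2) with (fun j => beta (m + j)%nat ^ 2) in sqr_le; nra.
Qed.

(** * Polynomials with nonpositive zeros *)

(* The operator [theta D + z D^2]. *)
Definition delta_coef (theta : R) (h : nat -> R) (k : nat) : R :=
  (INR k + 1) * (INR k + theta) * h (S k).

Inductive nonpos_rooted : (nat -> R) -> Prop :=
| nonpos_rooted_const c : nonpos_rooted (fun k => c * one_coef k)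
| nonpos_rooted_mul_linear p q h :
    0 <= p -> 0 <= q -> nonpos_rooted h -> nonpos_rooted (mul_linear p q h).

Lemma nonpos_rooted_ext h g : (forall k, h k = g k) -> nonpos_rooted h -> nonpos_rooted g.
Proof. intros hg; now rewrite (functional_extensionality _ _ hg). Qed.

Lemma nonpos_rooted_one_coef : nonpos_rooted one_coef.
Proof.
apply nonpos_rooted_ext with (fun k => 1 * one_coef k); [intros k; ring|].
apply nonpos_rooted_const.
Qed.

Lemma nonpos_rooted_mul_prod beta n h :
  (forall j, 0 <= beta j) -> nonpos_rooted h -> nonpos_rooted (mul_prod beta n h).
Proof.
intros beta_ge0; revert h; induction n as [|n IHn]; intros h h_rooted; simpl; [easy|].
apply IHn, nonpos_rooted_mul_linear; auto; lra.
Qed.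

Lemma nonpos_rooted_iter_shift l h : nonpos_rooted h -> nonpos_rooted (Nat.iter l shift h).
Proof.
intros h_rooted; induction l as [|l IHl]; [easy|].
apply nonpos_rooted_ext with (mul_linear 0 1 (Nat.iter l shift h)).
- intros k; unfold mul_linear; simpl; ring.
- apply nonpos_rooted_mul_linear; auto; lra.
Qed.

Lemma nonpos_rooted_finite_support h :
  nonpos_rooted h -> exists m, forall k, (m <= k)%nat -> h k = 0.
Proof.
induction 1 as [c|p q h _ _ _ [m h_0]].
- exists 1%nat; intros [|k] k_ge; [lia|simpl; ring].
- exists (S m); intros [|k] k_ge; [lia|]; unfold mul_linear; simpl shift; rewrite !h_0 by lia; ring.
Qed.

Module NonposRooted.
Set Implicit Arguments.
Unset Strict Implicit.
Unset Printing Implicit Defensive.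
Import all_boot all_order all_algebra complex Rstruct.
Import ring.
Import Order.TTheory GRing.Theory Num.Theory.
Local Open Scope ring_scope.

Section Polynomials.
Variable F : fieldType.
Implicit Types (x z t p q w : F) (xs : seq F) (f : {poly F}).

Definition rootprod xs : {poly F} := \prod_(x <- xs) ('X + x%:P).

Definition delta t f : {poly F} := t *: f^`() + 'X * f^`()^`().

Lemma rootprod_cons x xs : rootprod (x :: xs) = ('X + x%:P) * rootprod xs.
Proof. exact: big_cons. Qed.

Lemma horner_rootprod_neq0 xs z :
  {in xs, forall x, z + x != 0} -> (rootprod xs).[z] != 0.
Proof.
move=> roots_neq0; rewrite horner_prod big_seq prodf_seq_neq0.
by apply/allP => x _; apply/implyP => /roots_neq0; rewrite !hornerE.
Qed.

Lemma horner_deriv_rootprod xs z : {in xs, forall x, z + x != 0} ->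
  let s := \sum_(x <- xs) (z + x)^-1 in
  (rootprod xs)^`().[z] = (rootprod xs).[z] * s /\
  (rootprod xs)^`()^`().[z] =
    (rootprod xs).[z] * (s ^+ 2 - \sum_(x <- xs) (z + x) ^- 2).
Proof.
elim: xs => [|x xs IHxs] roots_neq0 /=.
  by rewrite /rootprod !big_nil derivC deriv0 !hornerE; split; ring.
have zx_neq0 : z + x != 0 by apply: roots_neq0; rewrite mem_head.
have [|IHderiv IHderiv2] := IHxs; first by move=> y ys; apply: roots_neq0; rewrite inE ys orbT.
rewrite rootprod_cons !big_cons !(derivM, derivD, derivX, derivC, addr0, mul1r).
rewrite !(hornerD, hornerM, hornerX, hornerC) IHderiv IHderiv2.
by split; field.
Qed.

Lemma horner_delta_rootprod xs t p q w :
  w != 0 -> {in xs, forall x, w ^+ 2 + x != 0} ->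
  let s := [seq w / (w ^+ 2 + x) | x <- xs] in
  let P := \sum_(r <- s) r in
  P != 0 ->
  (p *: rootprod xs + q *: delta t (rootprod xs)).[w ^+ 2] =
    (rootprod xs).[w ^+ 2] * P *
      (p / P + q * (t / w + (P ^+ 2 - \sum_(r <- s) r ^+ 2) / P)).
Proof.
move=> w_neq0 roots_neq0 s P; have [deriv_eq deriv2_eq] := horner_deriv_rootprod roots_neq0.
rewrite /delta !(hornerD, hornerZ, hornerM, hornerX) deriv_eq deriv2_eq.
have -> : P = w * \sum_(x <- xs) (w ^+ 2 + x)^-1 by rewrite /P big_map mulr_sumr.
have -> : \sum_(r <- s) r ^+ 2 = w ^+ 2 * \sum_(x <- xs) (w ^+ 2 + x) ^- 2.
  by rewrite big_map mulr_sumr; apply: eq_bigr => x _; rewrite exprMn exprVn.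
move: (\sum_(x <- xs) _) (\sum_(x <- xs) _) => sum_sqr_inv sum_inv.
by rewrite mulf_eq0 negb_or => /andP[_ sum_inv_neq0]; field; rewrite sum_inv_neq0.
Qed.

End Polynomials.

Section RightHalfPlane.
Variable C : numClosedFieldType.
Implicit Types (x z w p q t : C) (s xs : seq C).

Lemma Re_gt0_neq0 w : 0 < 'Re w -> w != 0.
Proof. by apply: contraTneq => ->; rewrite raddf0 ltxx. Qed.

Lemma Re_inv_gt0 w : 0 < 'Re w -> 0 < 'Re w^-1.
Proof.
by move=> w_rhp; rewrite ReV divr_gt0 // exprn_gt0 // normr_gt0 Re_gt0_neq0.
Qed.

Lemma Re_sum_gt0 s :
  {in s, forall p, 0 < 'Re p} -> s != [::] -> 0 < 'Re (\sum_(p <- s) p).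
Proof.
case: s => // p s s_rhp _; rewrite big_cons raddfD raddf_sum /=.
rewrite ltr_pwDl ?s_rhp ?mem_head // big_seq sumr_ge0 // => q q_s.
by rewrite ltW // s_rhp // inE q_s orbT.
Qed.

(* The sum is [\sum_p p (P - p) / P], and [p q / (p + q) = (p^-1 + q^-1)^-1]
   lies in the right half plane when p and q do. *)
Lemma Re_sum_parallel_gt0 s :
  {in s, forall p, 0 < 'Re p} -> (1 < size s)%N ->
  0 < 'Re (((\sum_(p <- s) p) ^+ 2 - \sum_(p <- s) p ^+ 2) / \sum_(p <- s) p).
Proof.
move=> s_rhp s_gt1; set P := \sum_(p <- s) p; have -> : (P ^+ 2 - \sum_(p <- s) p ^+ 2) / P =
    \sum_(q <- [seq p * (P - p) / P | p <- s]) q.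
  rewrite big_map expr2 {1}/P mulr_suml -sumrB mulr_suml.
  by apply: eq_bigr => p _; rewrite mulrBr expr2.
apply: Re_sum_gt0; last by rewrite -size_eq0 size_map -lt0n ltnW.
move=> _ /mapP[p p_s ->]; pose q := \sum_(r <- rem p s) r.
have q_rhp : 0 < 'Re q.
  apply: Re_sum_gt0; first by move=> r /mem_rem/s_rhp.
  by rewrite -size_eq0 size_rem // -lt0n ltn_predRL.
have p_rhp := s_rhp p p_s.
have -> : P = p + q by rewrite /P (big_rem p p_s).
have -> : p * (p + q - p) / (p + q) = (p^-1 + q^-1)^-1.
  by field; rewrite !Re_gt0_neq0 // raddfD addr_gt0.
by rewrite Re_inv_gt0 // raddfD addr_gt0 ?Re_inv_gt0.
Qed.

Lemma right_sqrtC z : ~~ (z <= 0) -> exists2 w, w ^+ 2 = z & 0 < 'Re w.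
Proof.
move=> z_nle0; have [Re_sign|Re_sign|Re_sign] := real_ltgt0P (Creal_Re (sqrtC z)).
- by exists (sqrtC z); rewrite ?sqrtCK.
- by exists (- sqrtC z); rewrite ?sqrrN ?sqrtCK // raddfN oppr_gt0.
- case/negP: z_nle0; rewrite -[z]sqrtCK [sqrtC z]Crect Re_sign add0r exprMn sqrCi.
  by rewrite mulN1r oppr_le0 real_exprn_even_ge0 ?Creal_Im.
Qed.

Lemma horner_delta_rootprod_neq0 xs t p q z :
  {in xs, forall x, 0 <= x} -> 0 <= t -> 0 <= p -> 0 <= q -> (p != 0) || (q != 0) ->
  (1 < size xs)%N -> ~~ (z <= 0) ->
  (p *: rootprod xs + q *: delta t (rootprod xs)).[z] != 0.
Proof.
move=> xs_ge0 t_ge0 p_ge0 q_ge0 pq_neq0 xs_gt1 z_nle0.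
have [w w_sqr w_rhp] := right_sqrtC z_nle0.
have w_neq0 := Re_gt0_neq0 w_rhp.
have zx_neq0 : {in xs, forall x, z + x != 0}.
  by move=> x /xs_ge0 x_ge0; apply: contra z_nle0; rewrite addr_eq0 => /eqP->; rewrite oppr_le0.
pose s := [seq w / (z + x) | x <- xs]; pose P := \sum_(r <- s) r.
have s_rhp : {in s, forall r, 0 < 'Re r}.
  move=> _ /mapP[x x_xs ->]; rewrite -invf_div Re_inv_gt0 //.
  have x_ge0 := xs_ge0 x x_xs; rewrite -w_sqr mulrDl expr2 mulfK // raddfD ltr_pwDl //=.
  by rewrite ReMl ?ger0_real // mulr_ge0 // ltW // Re_inv_gt0.
have P_rhp : 0 < 'Re P by apply: Re_sum_gt0; rewrite // -size_eq0 size_map; case: (xs) xs_gt1.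
have P_neq0 := Re_gt0_neq0 P_rhp.
rewrite -w_sqr horner_delta_rootprod ?w_sqr // -/s -/P.
rewrite !mulf_neq0 ?horner_rootprod_neq0 //; apply: Re_gt0_neq0.
have invP_rhp := Re_inv_gt0 P_rhp.
pose Q := (P ^+ 2 - \sum_(r <- s) r ^+ 2) / P; rewrite -/Q.
have tQ_rhp : 0 < 'Re (t / w + Q).
  rewrite raddfD /=; apply: ltr_pwDr.
    by apply: Re_sum_parallel_gt0; rewrite // size_map.
  by rewrite ReMl ?ger0_real // mulr_ge0 // ltW // Re_inv_gt0.
rewrite raddfD /= ReMl ?ger0_real // ReMl ?ger0_real //.
case/orP: pq_neq0 => [p_neq0|q_neq0].
- by apply: ltr_pwDl; [rewrite mulr_gt0 // lt0r p_neq0|rewrite mulr_ge0 // ltW].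
- by apply: ltr_pwDr; [rewrite mulr_gt0 // lt0r q_neq0|rewrite mulr_ge0 // ltW].
Qed.

Lemma root_delta_rootprod xs t p q z :
  {in xs, forall x, 0 <= x} -> 0 <= t -> 0 <= p -> 0 <= q ->
  let g := p *: rootprod xs + q *: delta t (rootprod xs) in
  g != 0 -> root g z -> z <= 0.
Proof.
move=> xs_ge0 t_ge0 p_ge0 q_ge0 g g_neq0 g_root; apply: contraT => z_nle0.
have pq_neq0 : (p != 0) || (q != 0).
  apply: contraNT g_neq0; rewrite negb_or !negbK /g => /andP[/eqP-> /eqP->].
  by rewrite !scale0r addr0.
case: (ltnP 1 (size xs)) => [xs_gt1|].
  by rewrite -(negbTE (horner_delta_rootprod_neq0 xs_ge0 t_ge0 p_ge0 q_ge0 pq_neq0 xs_gt1 z_nle0)).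
case: xs @g xs_ge0 g_neq0 g_root => [|x [|//]] g xs_ge0 g_neq0 g_root _.
  move: g_neq0 g_root; rewrite /g /rootprod big_nil /delta derivC deriv0 scaler0 mulr0 addr0.
  by rewrite scaler0 addr0 alg_polyC polyC_eq0 rootC => /negPf->.
have x_ge0 : 0 <= x by apply: xs_ge0; rewrite mem_head.
move: g_neq0 g_root; rewrite /g /rootprod big_seq1 /delta derivD derivX derivC addr0.
rewrite derivC mulr0 addr0 alg_polyC scale_polyC.
have [->|p_neq0] := eqVneq p 0.
  by rewrite scale0r add0r polyC_eq0 rootC => /negPf->.
rewrite rootE !hornerE => _ /eqP horner_eq0; case/negP: z_nle0.
have -> : z = - (x + q * t / p).
  apply: (mulfI p_neq0); rewrite mulrN mulrDr; apply/eqP; rewrite -addr_eq0; apply/eqP.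
  by rewrite -horner_eq0; field.
by rewrite oppr_le0 addr_ge0 // divr_ge0 ?mulr_ge0.
Qed.

End RightHalfPlane.

Lemma delta_rootprod_split (K : rcfType) (xs : seq K) (t p q : K) :
  {in xs, forall x, 0 <= x} -> 0 <= t -> 0 <= p -> 0 <= q ->
  exists c ys, {in ys, forall y : K, 0 <= y} /\
    p *: rootprod xs + q *: delta t (rootprod xs) = c *: rootprod ys.
Proof.
move=> xs_ge0 t_ge0 p_ge0 q_ge0; set g := _ + _.
have [g_eq0|g_neq0] := eqVneq g 0; first by exists 0, [::]; rewrite scale0r.
pose toC := real_complex K; have toC_ge0 x : (0 <= toC x) = (0 <= x) by rewrite lecR.
have map_rootprod ys : map_poly toC (rootprod ys) = rootprod (map toC ys).
  rewrite /rootprod rmorph_prod big_map; apply: eq_bigr => y _.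
  by rewrite rmorphD /= map_polyX map_polyC.
have gE : map_poly toC g =
    toC p *: rootprod (map toC xs) + toC q *: delta (toC t) (rootprod (map toC xs)).
  rewrite /g /delta rmorphD /= !map_polyZ rmorphD rmorphM /= map_polyZ map_polyX.
  by rewrite -!deriv_map map_rootprod.
have [rs rsE] := closed_field_poly_normal (map_poly toC g).
have rs_le0 r : r \in rs -> r <= 0.
  move=> r_rs; apply: (@root_delta_rootprod _ (map toC xs) (toC t) (toC p) (toC q)).
  - by move=> _ /mapP[x /xs_ge0 x_ge0 ->]; rewrite toC_ge0.
  - by rewrite toC_ge0.
  - by rewrite toC_ge0.
  - by rewrite toC_ge0.
  - by rewrite -gE map_poly_eq0.
  - by rewrite -gE rsE rootZ ?lead_coef_eq0 ?map_poly_eq0 // root_prod_XsubC.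
exists (lead_coef g), [seq - complex.Re r | r <- rs]; split.
  by move=> _ /mapP[r /rs_le0 r_le0 ->]; move: r_le0; rewrite lecE oppr_ge0 => /andP[].
apply: (@map_poly_inj _ _ toC); rewrite rsE map_polyZ lead_coef_map /= map_rootprod.
congr (_ *: _); rewrite /rootprod -map_comp big_map big_seq [RHS]big_seq.
apply: eq_bigr => r /rs_le0; rewrite lecE => /andP[/eqP Imr _].
by rewrite -polyCN; congr ('X + _%:P); case: r Imr => u v /= <-; rewrite /toC /= rmorphN.
Qed.

Definition has_coefs (h : nat -> R) (f : {poly R}) : Prop := forall k, h k = f`_k.

Lemma has_coefs_const c : has_coefs (fun k => Rmult c (one_coef k)) c%:P.
Proof. by move=> [|k]; rewrite RmultE coefC /= ?mulr1 ?mulr0. Qed.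

Lemma has_coefs_mul_linear p q h f :
  has_coefs h f -> has_coefs (mul_linear p q h) ((p%:P + q *: 'X) * f).
Proof.
move=> hE k; rewrite /mul_linear RplusE !RmultE mulrDl mul_polyC coefD coefZ hE.
by rewrite -scalerAl coefZ coefXM; case: k => [|k] /=; rewrite ?hE.
Qed.

Lemma has_coefs_shift h f : has_coefs h f -> has_coefs (shift h) ('X * f).
Proof. by move=> hE [|k]; rewrite coefXM //= hE. Qed.

Lemma has_coefs_delta theta h f :
  has_coefs h f -> has_coefs (delta_coef theta h) (delta theta f).
Proof.
move=> hE k; rewrite /delta_coef hE !RmultE !RplusE INRE R1E coefD coefZ coefXM !coef_deriv.
by case: k => [|k] /=; rewrite ?coef_deriv; ring.
Qed.

Lemma nonpos_rootedP h : nonpos_rooted h <->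
  exists c xs, {in xs, forall x : R, 0 <= x} /\ has_coefs h (c *: rootprod xs).
Proof.
split=> [|[c [xs [xs_ge0 hE]]]].
  elim=> [c|p q g /RleP p_ge0 /RleP q_ge0 _ [c [xs [xs_ge0 gE]]]].
    by exists c, [::]; split=> //; rewrite /rootprod big_nil alg_polyC; apply: has_coefs_const.
  have [q_eq0|q_neq0] := eqVneq q 0.
    exists (p * c), xs; split=> // k.
    by rewrite (has_coefs_mul_linear _ _ gE) q_eq0 scale0r addr0 mul_polyC scalerA.
  exists (q * c), (p / q :: xs); split.
    by move=> x; rewrite inE => /orP[/eqP->|/xs_ge0//]; rewrite divr_ge0.
  have pqE : p%:P + q *: 'X = q *: ('X + (p / q)%:P).
    by rewrite scalerDr scale_polyC mulrCA divff // mulr1 addrC.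
  by move=> k; rewrite (has_coefs_mul_linear _ _ gE) pqE rootprod_cons -scalerAl -scalerAr scalerA.
apply: (nonpos_rooted_ext (fun k => (c *: rootprod xs)`_k)) => // {h hE}.
elim: xs xs_ge0 => [|x xs IHxs] xs_ge0.
  apply: nonpos_rooted_ext (nonpos_rooted_const c) => k.
  by rewrite /rootprod big_nil alg_polyC has_coefs_const.
apply: (nonpos_rooted_ext (mul_linear x 1 (fun k => (c *: rootprod xs)`_k))) => [k|].
  rewrite (@has_coefs_mul_linear _ _ _ (c *: rootprod xs)) // scale1r addrC.
  by rewrite rootprod_cons scalerAr.
apply: nonpos_rooted_mul_linear; first by apply/RleP; rewrite xs_ge0 ?mem_head.
  by apply/RleP; rewrite ler01.
by apply: IHxs => y y_xs; apply: xs_ge0; rewrite inE y_xs orbT.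
Qed.

Lemma scal_closed c h : nonpos_rooted h -> nonpos_rooted (fun k => Rmult c (h k)).
Proof.
move=> /nonpos_rootedP[d [xs [xs_ge0 hE]]]; apply/nonpos_rootedP.
by exists (c * d), xs; split=> // k; rewrite hE -scalerA [RHS]coefZ.
Qed.

Lemma delta_closed theta p q h :
  Rle 0 theta -> Rle 0 p -> Rle 0 q -> nonpos_rooted h ->
  nonpos_rooted (fun k => Rplus (Rmult p (h k)) (Rmult q (delta_coef theta h k))).
Proof.
move=> /RleP theta_ge0 /RleP p_ge0 /RleP q_ge0 /nonpos_rootedP[c [xs [xs_ge0 hE]]].
have [d [ys [ys_ge0 ysE]]] := delta_rootprod_split xs_ge0 theta_ge0 p_ge0 q_ge0.
apply/nonpos_rootedP; exists (c * d), ys; split=> // k.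
rewrite (has_coefs_delta _ hE) hE -scalerA -ysE RplusE !RmultE.
rewrite !(coefZ, coefD, coefXM, coef_deriv).
by case: k => [|k] /=; rewrite ?(coefZ, coef_deriv); ring.
Qed.

Lemma has_coefs_mul_prod (ys : seq R) h f : has_coefs h f ->
  has_coefs (mul_prod (nth 0 ys) (size ys) h) (\prod_(y <- ys) (1 + y *: 'X) * f).
Proof.
move=> hE; elim: ys => [|y ys IHys] k; first by rewrite big_nil mul1r.
rewrite big_cons -mulrA -(has_coefs_mul_linear _ _ IHys).
by rewrite -[size _]/(Nat.add 1 (size ys)) mul_prod_add.
Qed.

Lemma factorization h : nonpos_rooted h ->
  exists c l ys, {in ys, forall y : R, 0 <= y} /\
    has_coefs h (c *: ('X^l * \prod_(y <- ys) (1 + y *: 'X))).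
Proof.
elim=> [c|p q g /RleP p_ge0 /RleP q_ge0 _ [c [l [ys [ys_ge0 gE]]]]].
  exists c, 0%N, [::]; split=> //; rewrite big_nil mulr1 expr0 alg_polyC.
  exact: has_coefs_const.
have [p_eq0|p_neq0] := eqVneq p 0.
  exists (q * c), l.+1, ys; split=> // k; rewrite (has_coefs_mul_linear _ _ gE) p_eq0 polyC0 add0r.
  by rewrite -scalerA -scalerAl -scalerAr exprS mulrA.
exists (p * c), l, (q / p :: ys); split.
  by move=> y; rewrite inE => /orP[/eqP->|/ys_ge0//]; rewrite divr_ge0.
have pqE : p%:P + q *: 'X = p *: (1 + (q / p) *: 'X).
  by rewrite scalerDr scalerA mulrCA divff // mulr1 alg_polyC.
move=> k; rewrite (has_coefs_mul_linear _ _ gE) pqE big_cons -scalerAl -scalerAr scalerA.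
by rewrite mulrCA.
Qed.

Lemma has_coefs_iter_shift l h f :
  has_coefs h f -> has_coefs (Nat.iter l shift h) ('X^l * f).
Proof.
move=> hE; elim: l => [|l IHl] k; first by rewrite expr0 mul1r.
by rewrite exprS -mulrA -(has_coefs_shift IHl).
Qed.

Lemma normal_form h : nonpos_rooted h ->
  exists c l beta N, nonneg_antitone beta /\ (forall j, (N <= j)%coq_nat -> beta j = 0) /\
    forall k, h k = Rmult c (Nat.iter l shift (mul_prod beta N one_coef) k).
Proof.
move=> /factorization[c [l [ys [ys_ge0 hE]]]].
pose s := sort >=%O ys.
have s_sorted : sorted >=%O s by apply: sort_sorted => x y; exact: le_total.
have nth_ge0 j : 0 <= nth 0 s j.
  case: (ltnP j (size s)) => j_s; last by rewrite nth_default.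
  by apply: ys_ge0; rewrite -(mem_sort >=%O) mem_nth.
exists c, l, (nth 0 s), (size s); split; last split.
- move=> j; split; apply/RleP => //; case: (ltnP j.+1 (size s)) => j_s.
    by move/sortedP: s_sorted => s_sorted; apply: s_sorted.
  by rewrite nth_default.
- by move=> j /ssrnat.leP s_j; rewrite nth_default.
- have one_coefE : has_coefs one_coef 1 by case=> [|k]; rewrite coefC.
  have prodE : \prod_(y <- s) (1 + y *: 'X) = \prod_(y <- ys) (1 + y *: 'X) :> {poly R}.
    by apply: perm_big; rewrite perm_sort.
  have prod_coefs := has_coefs_iter_shift l (has_coefs_mul_prod s one_coefE).
  by move=> k; rewrite hE prod_coefs prodE mulr1 coefZ.
Qed.

End NonposRooted.

Lemma nonpos_rooted_of_order h l :
  nonpos_rooted h -> h l <> 0 -> (forall k, (k < l)%nat -> h k = 0) ->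
  exists beta N, nonneg_antitone beta /\ (forall j, (N <= j)%nat -> beta j = 0) /\
    forall k, mul_prod beta N one_coef k = h (l + k)%nat / h l.
Proof.
intros h_rooted hl_neq0 h_low.
destruct (NonposRooted.normal_form h_rooted)
  as [c [m [beta [N [beta_na [zero_tail h_eq]]]]]].
assert (hm_eq : h m = c).
{ assert (leading := h_eq (m + 0)%nat).
  rewrite iter_shift_add, mul_prod_0, Nat.add_0_r in leading; simpl in leading; lra. }
assert (m_eq : m = l).
{ destruct (Nat.lt_total m l) as [m_l|[|l_m]]; [exfalso|easy|exfalso]; apply hl_neq0.
  - rewrite h_eq, <- hm_eq, h_low by easy; ring.
  - rewrite h_eq, iter_shift_lt by easy; ring. }
subst m; exists beta, N; split; [easy|split; [easy|]]; intros k.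
rewrite h_eq, iter_shift_add, <- hm_eq; now field.
Qed.

(** * Comparison with the exponential series *)

Definition exp_coef (s : R) (k : nat) : R := s ^ k / INR (fact k).

Lemma INR_fact_S k : INR (fact (S k)) = (INR k + 1) * INR (fact k).
Proof. now rewrite fact_simpl, mult_INR, S_INR. Qed.

Lemma exp_coef_0 : exp_coef 0 = one_coef.
Proof.
apply functional_extensionality; intros [|k]; unfold exp_coef; simpl; [field|].
unfold Rdiv; ring.
Qed.

Lemma exp_coef_ge0 s k : 0 <= s -> 0 <= exp_coef s k.
Proof. intros s_ge0; apply Rdiv_le_0_compat; [now apply pow_le|apply INR_fact_lt_0]. Qed.

Lemma exp_coef_le s t k : 0 <= s <= t -> exp_coef s k <= exp_coef t k.
Proof.
intros st; apply Rmult_le_compat_r; [|now apply pow_incr].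
left; apply Rinv_0_lt_compat, INR_fact_lt_0.
Qed.

Lemma exp_coef_continuous (s : nat -> R) (t : R) k :
  is_lim_seq s t -> is_lim_seq (fun n => exp_coef (s n) k) (exp_coef t k).
Proof.
intros s_t; apply is_lim_seq_mult'; [|apply is_lim_seq_const].
induction k; simpl; [apply is_lim_seq_const|now apply is_lim_seq_mult'].
Qed.

Lemma pow_tangent_le a b k : 0 <= a -> 0 <= b ->
  b ^ S k + (INR k + 1) * (a - b) * b ^ k <= a ^ S k.
Proof.
intros a_ge0 b_ge0; induction k as [|k IHk]; [simpl; lra|].
apply (Rmult_le_compat_l a) in IHk; [|easy].
assert (curvature : 0 <= (INR k + 1) * b ^ k * (a - b) ^ 2).
{ assert (k_ge0 := pos_INR k); apply Rmult_le_pos; [|apply pow2_ge_0].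
  apply Rmult_le_pos; [lra|now apply pow_le]. }
rewrite S_INR; simpl in *; lra.
Qed.

Lemma exp_coef_tangent_le a b k : 0 <= a -> 0 <= b ->
  mul_linear 1 (a - b) (exp_coef b) k <= exp_coef a k.
Proof.
intros a_ge0 b_ge0; destruct k as [|k]; unfold mul_linear, exp_coef; simpl shift; [simpl; lra|].
rewrite INR_fact_S; assert (fact_gt0 := INR_fact_lt_0 k); assert (k_ge0 := pos_INR k).
replace (1 * (b ^ S k / ((INR k + 1) * INR (fact k))) + (a - b) * (b ^ k / INR (fact k)))
  with ((b ^ S k + (INR k + 1) * (a - b) * b ^ k) / ((INR k + 1) * INR (fact k)))
  by (field; lra).
apply Rmult_le_compat_r; [|now apply pow_tangent_le].
left; apply Rinv_0_lt_compat; nra.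
Qed.

Lemma exp_coef_add_le s w k : 0 <= s -> 0 <= w ->
  exp_coef (s + w) k <= exp_coef s k + w * shift (exp_coef (s + w)) k.
Proof.
intros s_ge0 w_ge0; assert (tangent := exp_coef_tangent_le s (s + w) k).
unfold mul_linear in tangent; lra.
Qed.

Lemma exp_coef_sub_mul_linear_le s w k : 0 <= s -> 0 <= w ->
  exp_coef (s + w) k - mul_linear 1 w (exp_coef s) k <= w ^ 2 * shift (shift (exp_coef (s + w))) k.
Proof.
intros s_ge0 w_ge0; assert (first_order := exp_coef_add_le s w k s_ge0 w_ge0).
unfold mul_linear.
assert (shift_first_order : shift (exp_coef (s + w)) k - shift (exp_coef s) k
          <= w * shift (shift (exp_coef (s + w))) k).
{ destruct k as [|k]; simpl; [lra|].
  assert (first_order_pred := exp_coef_add_le s w k s_ge0 w_ge0); lra. }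
apply (Rmult_le_compat_l w) in shift_first_order; lra.
Qed.

Lemma mul_prod_exp_coef_le beta n s k : (forall j, 0 <= beta j) -> 0 <= s ->
  mul_prod beta n (exp_coef s) k <= exp_coef (s + partial_sum beta n) k.
Proof.
intros beta_ge0; revert s; induction n as [|n IHn]; intros s s_ge0; simpl.
{ rewrite Rplus_0_r; lra. }
replace (s + (partial_sum beta n + beta n)) with (s + beta n + partial_sum beta n) by ring.
eapply Rle_trans; [|apply IHn; specialize (beta_ge0 n); lra].
apply mul_prod_le; auto; intros i.
replace (beta n) with (s + beta n - s) at 1 by ring.
apply exp_coef_tangent_le; auto; specialize (beta_ge0 n); lra.
Qed.

Lemma exp_coef_sub_mul_prod_le beta n s k : (forall j, 0 <= beta j) -> 0 <= s ->
  exp_coef (s + partial_sum beta n) k - mul_prod beta n (exp_coef s) k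
    <= partial_sum (fun j => beta j ^ 2) n * shift (shift (exp_coef (s + partial_sum beta n))) k.
Proof.
intros beta_ge0; revert s k; induction n as [|n IHn]; intros s k s_ge0.
{ simpl; rewrite Rplus_0_r; lra. }
assert (w_ge0 := beta_ge0 n); assert (sw_ge0 : 0 <= s + beta n) by lra.
set (w := beta n) in *; set (t := s + partial_sum beta (S n)).
assert (t_eq : s + w + partial_sum beta n = t) by (unfold t, w; simpl; ring).
assert (tail := IHn (s + w) k sw_ge0); rewrite t_eq in tail.
assert (last_factor : mul_prod beta n (exp_coef (s + w)) k
     <= mul_prod beta (S n) (exp_coef s) k + w ^ 2 * shift (shift (exp_coef t)) k).
{ apply Rle_trans with (mul_prod beta n (fun i => 1 * mul_linear 1 w (exp_coef s) i +
                          w ^ 2 * shift (shift (exp_coef (s + w))) i) k).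
  - apply mul_prod_le; auto; intros i.
    assert (quadratic := exp_coef_sub_mul_linear_le s w i s_ge0 w_ge0); lra.
  - rewrite mul_prod_comb, Rmult_1_l; apply Rplus_le_compat_l.
    apply Rmult_le_compat_l; [apply pow2_ge_0|].
    rewrite !mul_prod_shift; do 2 (apply shift_le; intros ?).
    rewrite <- t_eq; now apply mul_prod_exp_coef_le. }
simpl in *; fold w in last_factor |- *; lra.
Qed.

Lemma mul_prod_exp_coef_tail_bounds beta m n k : (forall j, 0 <= beta j) ->
  let tail := fun j => beta (m + j)%nat in
  0 <= mul_prod beta m (exp_coef (partial_sum tail n)) k - mul_prod beta (m + n) one_coef k
    <= partial_sum (fun j => tail j ^ 2) n * shift (shift (exp_coef (partial_sum beta (m + n)))) k.
Proof.
intros beta_ge0 tail; assert (tail_ge0 : forall j, 0 <= tail j) by (intros j; apply beta_ge0).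
set (t := partial_sum tail n); set (sq := partial_sum (fun j => tail j ^ 2) n).
assert (t_ge0 : 0 <= t) by now apply partial_sum_ge0.
replace (mul_prod beta m (exp_coef t) k - mul_prod beta (m + n) one_coef k)
  with (mul_prod beta m (fun i => 1 * exp_coef t i + -1 * mul_prod tail n (exp_coef 0) i) k).
2:{ rewrite mul_prod_comb, exp_coef_0, mul_prod_add; fold tail; ring. }
split.
- apply mul_prod_ge0; auto; intros i.
  assert (upper := mul_prod_exp_coef_le tail n 0 i tail_ge0 (Rle_refl 0)).
  rewrite Rplus_0_l in upper; fold t in upper; lra.
- apply Rle_trans with
    (mul_prod beta m (fun i => 0 * exp_coef t i + sq * shift (shift (exp_coef t)) i) k).
  + apply mul_prod_le; auto; intros i.
    assert (lower := exp_coef_sub_mul_prod_le tail n 0 i tail_ge0 (Rle_refl 0)).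
    rewrite Rplus_0_l in lower; fold t sq in lower; lra.
  + rewrite mul_prod_comb, !mul_prod_shift, Rmult_0_l, Rplus_0_l.
    apply Rmult_le_compat_l; [apply partial_sum_ge0; intros j; apply pow2_ge_0|].
    do 2 (apply shift_le; intros ?); rewrite partial_sum_add, Rplus_comm.
    now apply mul_prod_exp_coef_le.
Qed.

Lemma head_exp_tail_bounds beta N m k (s := partial_sum beta N) :
  nonneg_antitone beta -> (forall j, (N <= j)%nat -> beta j = 0) ->
  let gap := mul_prod beta m (exp_coef (s - partial_sum beta m)) k - mul_prod beta N one_coef k in
  0 <= gap /\ INR m * gap <= s ^ 2 * shift (shift (exp_coef s)) k.
Proof.
intros beta_na zero_tail gap; assert (beta_ge0 := nonneg_antitone_ge0 beta beta_na).
assert (s_eq : partial_sum beta (m + N) = s).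
{ rewrite Nat.add_comm; now apply partial_sum_zero_tail. }
assert (prod_eq : mul_prod beta (m + N) one_coef = mul_prod beta N one_coef).
{ rewrite Nat.add_comm; now apply mul_prod_zero_tail. }
assert (bounds := mul_prod_exp_coef_tail_bounds beta m N k beta_ge0); simpl in bounds.
assert (sqr_le := tail_sum_sqr_le beta m N beta_na).
assert (tail_eq := partial_sum_add beta m N).
rewrite prod_eq, s_eq in *.
replace (partial_sum (fun j => beta (m + j)%nat) N) with (s - partial_sum beta m) in bounds by lra.
fold gap in bounds; split; [apply bounds|].
apply Rle_trans with (INR m * partial_sum (fun j => beta (m + j)%nat ^ 2) N
                        * shift (shift (exp_coef s)) k).
- rewrite Rmult_assoc; apply Rmult_le_compat_l; [apply pos_INR|apply bounds].
- apply Rmult_le_compat_r; [|easy].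
  do 2 (apply shift_ge0; intros ?); apply exp_coef_ge0; now apply partial_sum_ge0.
Qed.

(** * Limits of real sequences and series *)

Lemma ex_series_bounded (a : nat -> R) (M : R) :
  (forall k, 0 <= a k) -> (forall n, sum_n a n <= M) -> ex_series a /\ Series a <= M.
Proof.
intros a_ge0 sum_le.
destruct (ex_finite_lim_seq_incr (sum_n a) M) as [l sum_l]; auto.
{ intros n; rewrite sum_n_S; specialize (a_ge0 (S n)); lra. }
assert (a_l : is_series a l) by exact sum_l.
split; [now exists l|]; rewrite (is_series_unique _ _ a_l).
exact (is_lim_seq_le _ _ (Finite l) (Finite M) sum_le sum_l (is_lim_seq_const M)).
Qed.

Lemma is_series_zero {K : AbsRing} {V : NormedModule K} : is_series (fun _ : nat => @zero V) zero.
Proof.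
apply filterlim_ext with (fun _ => zero); [|apply filterlim_const].
intros n; induction n as [|n IHn]; [now rewrite sum_O|]; now rewrite sum_Sn, <- IHn, plus_zero_l.
Qed.

Lemma ex_series_finite_support (a : nat -> R) m :
  (forall k, (m <= k)%nat -> a k = 0) -> ex_series a.
Proof.
intros a_0; apply (ex_series_incr_n a m); exists 0.
eapply is_series_ext; [|exact is_series_zero]; intros k; rewrite a_0 by lia; easy.
Qed.

Lemma is_lim_seq_close (u : nat -> R) (l eps : R) :
  is_lim_seq u l -> 0 < eps -> eventually (fun n => Rabs (u n - l) < eps).
Proof. intros u_l eps_gt0; exact (proj2 (is_lim_seq_spec u l) u_l (mkposreal eps eps_gt0)). Qed.

Lemma is_lim_seq_inv_S : is_lim_seq (fun n => / INR (S n)) 0.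
Proof.
apply (is_lim_seq_incr_1 (fun n => / INR n)).
apply (is_lim_seq_inv INR p_infty); [apply is_lim_seq_INR|easy].
Qed.

Lemma eventually_inv_S_lt eps : 0 < eps -> eventually (fun n => / INR (S n) < eps).
Proof.
intros eps_gt0; destruct (is_lim_seq_close _ 0 eps is_lim_seq_inv_S eps_gt0) as [N N_close].
exists N; intros n N_n; specialize (N_close n N_n); rewrite Rminus_0_r in N_close.
exact (Rle_lt_trans _ _ _ (Rle_abs _) N_close).
Qed.

Lemma is_lim_seq_sum_n (a : nat -> nat -> R) (b : nat -> R) K :
  (forall k, is_lim_seq (fun n => a n k) (b k)) ->
  is_lim_seq (fun n => sum_n (a n) K) (sum_n b K).
Proof.
intros a_b; induction K as [|K IHK].
- rewrite sum_O; apply is_lim_seq_ext with (fun n => a n O); auto; intros n; now rewrite sum_O.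
- rewrite sum_n_S; apply is_lim_seq_ext with (fun n => sum_n (a n) K + a n (S K)).
  + intros n; now rewrite sum_n_S.
  + now apply is_lim_seq_plus'.
Qed.

Lemma Series_remainder_le (a M : nat -> R) K :
  ex_series M -> (forall k, Rabs (a k) <= M k) ->
  Rabs (Series a - sum_n a K) <= Series M - sum_n M K.
Proof.
intros M_summable a_le.
assert (a_summable : ex_series a).
{ exact (ex_series_le (V := R_CompleteNormedModule) a M a_le M_summable). }
rewrite (Series_incr_n a (S K)), (Series_incr_n M (S K)) by (auto; lia).
rewrite !sum_n_Reals; simpl pred.
replace (sum_f_R0 a K + Series (fun k => a (S K + k)%nat) - sum_f_R0 a K)
  with (Series (fun k => a (S K + k)%nat)) by ring.
replace (sum_f_R0 M K + Series (fun k => M (S K + k)%nat) - sum_f_R0 M K)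
  with (Series (fun k => M (S K + k)%nat)) by ring.
assert (tail_summable : ex_series (fun k => M (S K + k)%nat)) by now apply ex_series_incr_n.
eapply Rle_trans; [apply Series_Rabs|apply Series_le; auto; intros k; split; auto; apply Rabs_pos].
apply (ex_series_le (V := R_CompleteNormedModule) _ (fun k => M (S K + k)%nat)); auto.
intros k; simpl; unfold norm, abs; simpl; now rewrite Rabs_Rabsolu.
Qed.

Lemma is_lim_seq_Series_dominated (a : nat -> nat -> R) (b M : nat -> R) :
  ex_series M -> (forall n k, Rabs (a n k) <= M k) ->
  (forall k, is_lim_seq (fun n => a n k) (b k)) ->
  is_lim_seq (fun n => Series (a n)) (Series b).
Proof.
intros M_summable a_le a_b.
assert (b_le : forall k, Rabs (b k) <= M k).
{ intros k; exact (is_lim_seq_le _ _ (Finite (Rabs (b k))) (Finite (M k)) (fun n => a_le n k)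
    (is_lim_seq_abs _ _ (a_b k)) (is_lim_seq_const _)). }
apply is_lim_seq_spec; intros eps; assert (eps3_gt0 : 0 < eps / 3) by (destruct eps; simpl; lra).
destruct (is_lim_seq_close (sum_n M) _ _ (Series_correct _ M_summable) eps3_gt0) as [K tail_lt].
specialize (tail_lt K (Nat.le_refl K)); apply Rabs_def2 in tail_lt.
destruct (is_lim_seq_close (fun n => sum_n (a n) K) _ _ (is_lim_seq_sum_n a b K a_b) eps3_gt0)
  as [N head_lt].
exists N; intros n N_n; specialize (head_lt n N_n); apply Rabs_def2 in head_lt.
assert (a_tail := Series_remainder_le (a n) M K M_summable (a_le n)).
assert (b_tail := Series_remainder_le b M K M_summable b_le).
apply Rabs_le_between in a_tail, b_tail.
apply Rabs_def1; lra.
Qed.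

Lemma least_nonzero_index (w : nat -> R) : (exists k, w k <> 0) ->
  exists l, w l <> 0 /\ forall k, (k < l)%nat -> w k = 0.
Proof.
intros w_neq0; destruct (dec_inh_nat_subset_has_unique_least_element (fun k => w k <> 0))
  as [l [[wl_neq0 l_least] _]]; auto; [intros k; apply classic|].
exists l; split; auto; intros k k_l; destruct (Req_dec (w k) 0) as [|wk_neq0]; auto.
specialize (l_least k wk_neq0); lia.
Qed.

Section DiagonalExtraction.

Variables (B : nat -> nat -> R) (lower upper : nat -> R).
Hypothesis B_bounded : forall n j, lower j <= B n j <= upper j.

Definition prefix_cluster (beta : nat -> R) (J : nat) : Prop :=
  forall (m : nat) (eps : R), 0 < eps ->
    exists n, (m <= n)%nat /\ forall j, (j < J)%nat -> Rabs (B n j - beta j) < eps.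

Lemma prefix_cluster_subsequence beta (J : nat -> nat) : (forall m, prefix_cluster beta (J m)) ->
  exists phi, forall m, (m <= phi m)%nat /\
    forall j, (j < J m)%nat -> Rabs (B (phi m) j - beta j) < / INR (S m).
Proof.
intros cluster; apply (functional_choice (fun m n => (m <= n)%nat /\
  forall j, (j < J m)%nat -> Rabs (B n j - beta j) < / INR (S m))).
intros m; apply cluster, Rinv_0_lt_compat, lt_0_INR; lia.
Qed.

Definition update (beta : nat -> R) (J : nat) (x : R) (j : nat) : R :=
  if Nat.eqb j J then x else beta j.

Lemma prefix_cluster_extend beta J :
  prefix_cluster beta J -> exists x, prefix_cluster (update beta J x) (S J).
Proof.
intros cluster; destruct (prefix_cluster_subsequence beta (fun _ => J) (fun _ => cluster))
  as [phi phiP].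
destruct (Bolzano_Weierstrass (fun m => B (phi m) J) (fun x => lower J <= x <= upper J))
  as [x x_adherent].
{ apply compact_P3. }
{ intros m; apply B_bounded. }
exists x; intros m eps eps_gt0; destruct (eventually_inv_S_lt eps eps_gt0) as [N N_eps].
destruct (x_adherent (disc x (mkposreal eps eps_gt0)) (max m N)) as [p [p_ge p_close]].
{ now exists (mkposreal eps eps_gt0). }
destruct (phiP p) as [phi_ge phi_close]; exists (phi p); split; [lia|].
intros j j_lt; unfold update; destruct (Nat.eqb_spec j J) as [->|j_neq]; [exact p_close|].
eapply Rlt_trans; [apply phi_close; lia|apply N_eps; lia].
Qed.

Lemma prefix_cluster_exists : exists beta, forall J, prefix_cluster beta J.
Proof.
destruct (functional_choice (fun (p : (nat -> R) * nat) x =>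
    prefix_cluster (fst p) (snd p) ->
    prefix_cluster (update (fst p) (snd p) x) (S (snd p)))) as [next nextP].
{ intros [beta J]; destruct (classic (prefix_cluster beta J)) as [cluster|no_cluster].
  - destruct (prefix_cluster_extend beta J cluster) as [x xP]; now exists x.
  - exists 0; intros cluster; contradiction. }
set (prefix := nat_rect (fun _ => nat -> R) (fun _ => 0)
  (fun J beta => update beta J (next (beta, J)))).
assert (prefix_stable : forall j J, (j < J)%nat -> prefix J j = prefix (S j) j).
{ intros j J; induction 1 as [|J j_J IHJ]; [easy|]; rewrite <- IHJ; simpl; unfold update.
  destruct (Nat.eqb_spec j J); [lia|easy]. }
exists (fun j => prefix (S j) j); intros J.
assert (cluster : prefix_cluster (prefix J) J).
{ induction J as [|J IHJ]; [|now apply (nextP (_, _))].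
  intros m eps _; exists m; split; [lia|intros; lia]. }
intros m eps eps_gt0; destruct (cluster m eps eps_gt0) as [n [n_ge n_close]].
exists n; split; auto; intros j j_J; rewrite <- (prefix_stable j J); auto.
Qed.

Lemma diagonal_extraction : exists (phi : nat -> nat) (beta : nat -> R),
  filterlim phi eventually eventually /\ forall j, is_lim_seq (fun n => B (phi n) j) (beta j).
Proof.
destruct prefix_cluster_exists as [beta cluster].
destruct (prefix_cluster_subsequence beta (fun m => m) cluster) as [phi phiP].
exists phi, beta; split.
- intros P [N PN]; exists N; intros n N_n; apply PN; destruct (phiP n); lia.
- intros j; apply is_lim_seq_spec; intros eps.
  destruct (eventually_inv_S_lt eps (cond_pos eps)) as [N N_eps].
  exists (max (S j) N); intros n n_ge; destruct (phiP n) as [_ phi_close].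
  eapply Rlt_trans; [apply phi_close; lia|apply N_eps; lia].
Qed.

End DiagonalExtraction.

(** * The Laguerre-Polya class *)

Section SummableFactors.

Variable beta : nat -> R.
Hypotheses (beta_ge0 : forall j, 0 <= beta j) (beta_summable : ex_series beta).

Lemma is_lim_seq_partial_sum : is_lim_seq (partial_sum beta) (Series beta).
Proof.
apply is_lim_seq_incr_1; apply is_lim_seq_ext with (sum_n beta).
{ intros n; now rewrite partial_sum_S. }
now apply Series_correct.
Qed.

Lemma partial_sum_le_Series n : partial_sum beta n <= Series beta.
Proof.
apply (is_lim_seq_incr_compare _ _ is_lim_seq_partial_sum); intros m; simpl.
specialize (beta_ge0 m); lra.
Qed.

(* The coefficients of [exp (alpha z) * prod_j (1 + beta j z)]. *)
Definition laguerre_coef (alpha : R) (k : nat) : R :=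
  real (Lim_seq (fun n => mul_prod beta n (exp_coef alpha) k)).

Variable alpha : R.
Hypothesis alpha_ge0 : 0 <= alpha.

Lemma mul_prod_exp_coef_le_Series n k :
  mul_prod beta n (exp_coef alpha) k <= exp_coef (alpha + Series beta) k.
Proof.
eapply Rle_trans; [now apply mul_prod_exp_coef_le|].
assert (sum_ge0 := partial_sum_ge0 beta beta_ge0 n).
assert (sum_le := partial_sum_le_Series n); apply exp_coef_le; lra.
Qed.

Lemma is_lim_seq_laguerre_coef k :
  is_lim_seq (fun n => mul_prod beta n (exp_coef alpha) k) (laguerre_coef alpha k).
Proof.
apply Lim_seq_correct', ex_finite_lim_seq_incr with (exp_coef (alpha + Series beta) k).
- intros n; apply mul_prod_le_S; auto; intros i; now apply exp_coef_ge0.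
- intros n; apply mul_prod_exp_coef_le_Series.
Qed.

Lemma mul_prod_le_laguerre_coef n k :
  mul_prod beta n (exp_coef alpha) k <= laguerre_coef alpha k.
Proof.
apply (is_lim_seq_incr_compare _ _ (is_lim_seq_laguerre_coef k)); intros m.
apply mul_prod_le_S; auto; intros i; now apply exp_coef_ge0.
Qed.

Lemma is_lim_seq_mul_prod_exp_tail k :
  is_lim_seq (fun n => mul_prod beta n (exp_coef (alpha + (Series beta - partial_sum beta n))) k)
    (laguerre_coef alpha k).
Proof.
set (r := fun n => Series beta - partial_sum beta n).
assert (r_ge0 : forall n, 0 <= r n).
{ intros n; assert (sum_le := partial_sum_le_Series n); unfold r; lra. }
set (E := shift (exp_coef (alpha + Series beta)) k).
apply is_lim_seq_le_le with (fun n => mul_prod beta n (exp_coef alpha) k)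
  (fun n => mul_prod beta n (exp_coef alpha) k + r n * E).
- intros n; fold (r n); specialize (r_ge0 n); split.
  + apply mul_prod_le; auto; intros i; apply exp_coef_le; lra.
  + apply Rle_trans with (mul_prod beta n (fun i => 1 * exp_coef alpha i +
                             r n * shift (exp_coef (alpha + r n)) i) k).
    { apply mul_prod_le; auto; intros i; rewrite Rmult_1_l; now apply exp_coef_add_le. }
    rewrite mul_prod_comb, Rmult_1_l, mul_prod_shift; apply Rplus_le_compat_l.
    apply Rmult_le_compat_l; auto; apply shift_le; intros i.
    replace (alpha + Series beta) with (alpha + r n + partial_sum beta n) by (unfold r; ring).
    apply mul_prod_exp_coef_le; auto; lra.
- apply is_lim_seq_laguerre_coef.
- replace (Finite (laguerre_coef alpha k))
    with (Finite (laguerre_coef alpha k + (Series beta - Series beta) * E)) by (f_equal; ring).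
  apply is_lim_seq_plus'; [apply is_lim_seq_laguerre_coef|].
  apply is_lim_seq_mult'; [|apply is_lim_seq_const].
  apply is_lim_seq_minus'; [apply is_lim_seq_const|apply is_lim_seq_partial_sum].
Qed.

Definition laguerre_approx (n : nat) : nat -> R :=
  mul_prod beta n (mul_prod (fun _ => alpha / INR (S n)) (S n) one_coef).

Lemma exp_coef_sub_mul_prod_const_bounds n k (w := alpha / INR (S n)) :
  0 <= exp_coef alpha k - mul_prod (fun _ => w) (S n) one_coef k
    <= alpha ^ 2 * / INR (S n) * shift (shift (exp_coef alpha)) k.
Proof.
assert (S_gt0 : 0 < INR (S n)) by (apply lt_0_INR; lia).
assert (w_ge0 : forall j : nat, 0 <= w) by (intros _; now apply Rdiv_le_0_compat).
assert (upper := mul_prod_exp_coef_le (fun _ => w) (S n) 0 k w_ge0 (Rle_refl 0)).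
assert (lower := exp_coef_sub_mul_prod_le (fun _ => w) (S n) 0 k w_ge0 (Rle_refl 0)).
rewrite !partial_sum_const, Rplus_0_l, exp_coef_0 in *.
replace (INR (S n) * w) with alpha in * by (unfold w; field; lra).
replace (INR (S n) * w ^ 2) with (alpha ^ 2 * / INR (S n)) in lower by (unfold w; field; lra).
lra.
Qed.

Lemma laguerre_approx_bounds n k :
  mul_prod beta n (exp_coef alpha) k
    - alpha ^ 2 * / INR (S n) * shift (shift (mul_prod beta n (exp_coef alpha))) k
  <= laguerre_approx n k <= mul_prod beta n (exp_coef alpha) k.
Proof.
split.
- rewrite <- !mul_prod_shift.
  apply Rle_trans with (mul_prod beta n (fun i => 1 * exp_coef alpha i
    + - (alpha ^ 2 * / INR (S n)) * shift (shift (exp_coef alpha)) i) k).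
  { rewrite mul_prod_comb; lra. }
  apply mul_prod_le; auto; intros i; assert (bounds := exp_coef_sub_mul_prod_const_bounds n i); lra.
- apply mul_prod_le; auto; intros i; assert (bounds := exp_coef_sub_mul_prod_const_bounds n i); lra.
Qed.

Lemma is_lim_seq_laguerre_approx k :
  is_lim_seq (fun n => laguerre_approx n k) (laguerre_coef alpha k).
Proof.
eapply is_lim_seq_le_le; [intros n; apply laguerre_approx_bounds| |apply is_lim_seq_laguerre_coef].
set (E := shift (shift (laguerre_coef alpha)) k).
replace (Finite (laguerre_coef alpha k))
  with (Finite (laguerre_coef alpha k - alpha ^ 2 * 0 * E)) by (f_equal; ring).
apply is_lim_seq_minus'; [apply is_lim_seq_laguerre_coef|apply is_lim_seq_mult'].
- apply is_lim_seq_mult'; [apply is_lim_seq_const|apply is_lim_seq_inv_S].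
- unfold E; destruct k as [|[|k]]; simpl;
    [apply is_lim_seq_const..|apply is_lim_seq_laguerre_coef].
Qed.

Lemma laguerre_approx_le n k : 0 <= laguerre_approx n k <= laguerre_coef alpha k.
Proof.
split.
- apply mul_prod_ge0; auto; intros i; apply mul_prod_ge0.
  + intros _; apply Rdiv_le_0_compat; [easy|apply lt_0_INR; lia].
  + intros [|j]; simpl; lra.
- eapply Rle_trans; [apply laguerre_approx_bounds|apply mul_prod_le_laguerre_coef].
Qed.

Lemma laguerre_approx_rooted n : nonpos_rooted (laguerre_approx n).
Proof.
apply nonpos_rooted_mul_prod, nonpos_rooted_mul_prod, nonpos_rooted_one_coef; auto.
intros _; apply Rdiv_le_0_compat; [easy|apply lt_0_INR; lia].
Qed.

End SummableFactors.

Section PointwiseLimit.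

Variables (B : nat -> nat -> R) (N : nat -> nat) (u beta : nat -> R).
Hypotheses (B_na : forall n, nonneg_antitone (B n))
  (B_zero_tail : forall n j, (N n <= j)%nat -> B n j = 0)
  (B_beta : forall j, is_lim_seq (fun n => B n j) (beta j))
  (prod_u : forall k, is_lim_seq (fun n => mul_prod (B n) (N n) one_coef k) (u k)).

Lemma nonneg_antitone_lim : nonneg_antitone beta.
Proof.
intros j; split.
- exact (is_lim_seq_le _ _ (Finite 0) (Finite (beta (S j)))
    (fun n => proj1 (B_na n j)) (is_lim_seq_const 0) (B_beta (S j))).
- exact (is_lim_seq_le _ _ (Finite (beta (S j))) (Finite (beta j))
    (fun n => proj2 (B_na n j)) (B_beta (S j)) (B_beta j)).
Qed.

Lemma is_lim_seq_full_sum : is_lim_seq (fun n => partial_sum (B n) (N n)) (u 1%nat).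
Proof.
apply is_lim_seq_ext with (fun n => mul_prod (B n) (N n) one_coef 1); [|apply prod_u].
intros n; rewrite mul_prod_1; simpl; ring.
Qed.

Lemma partial_sum_le_full m : partial_sum beta m <= u 1%nat.
Proof.
apply (is_lim_seq_le (fun n => partial_sum (B n) m) (fun n => partial_sum (B n) (N n))
  (Finite (partial_sum beta m)) (Finite (u 1%nat)));
  [|now apply partial_sum_continuous|apply is_lim_seq_full_sum].
intros n; assert (Bn_ge0 := nonneg_antitone_ge0 _ (B_na n)).
rewrite <- (partial_sum_zero_tail (B n) (N n) m (B_zero_tail n)), Nat.add_comm, partial_sum_add.
assert (tail_ge0 := partial_sum_ge0 (fun j => B n (m + j)%nat) (fun j => Bn_ge0 _) (N n)); lra.
Qed.

Lemma head_exp_tail_bounds_lim m k :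
  let gap := mul_prod beta m (exp_coef (u 1%nat - partial_sum beta m)) k - u k in
  0 <= gap /\ INR m * gap <= u 1%nat ^ 2 * shift (shift (exp_coef (u 1%nat))) k.
Proof.
set (gap_at := fun n => mul_prod (B n) m
  (exp_coef (partial_sum (B n) (N n) - partial_sum (B n) m)) k - mul_prod (B n) (N n) one_coef k).
intros gap; assert (gap_cv : is_lim_seq gap_at gap).
{ apply is_lim_seq_minus'; [|apply prod_u].
  apply mul_prod_continuous; [exact B_beta|intros i; apply exp_coef_continuous].
  apply is_lim_seq_minus'; [apply is_lim_seq_full_sum|now apply partial_sum_continuous]. }
set (bound_at := fun n => let s := partial_sum (B n) (N n) in s ^ 2 * shift (shift (exp_coef s)) k).
assert (bound_cv : is_lim_seq bound_at (u 1%nat ^ 2 * shift (shift (exp_coef (u 1%nat))) k)).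
{ apply is_lim_seq_mult'.
  - simpl; repeat apply is_lim_seq_mult'; try apply is_lim_seq_const; apply is_lim_seq_full_sum.
  - destruct k as [|[|i]]; simpl;
      [apply is_lim_seq_const..|apply exp_coef_continuous, is_lim_seq_full_sum]. }
assert (bounds : forall n, 0 <= gap_at n /\ INR m * gap_at n <= bound_at n).
{ intros n; apply head_exp_tail_bounds; auto. }
split.
- exact (is_lim_seq_le _ _ (Finite 0) (Finite gap) (fun n => proj1 (bounds n))
    (is_lim_seq_const 0) gap_cv).
- exact (is_lim_seq_le _ _ (Finite (INR m * gap)) (Finite _) (fun n => proj2 (bounds n))
    (is_lim_seq_mult' _ _ _ _ (is_lim_seq_const (INR m)) gap_cv) bound_cv).
Qed.

Lemma mul_prod_lim_eq_laguerre_coef :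
  ex_series beta /\ Series beta <= u 1%nat /\
  forall k, u k = laguerre_coef beta (u 1%nat - Series beta) k.
Proof.
assert (beta_ge0 := nonneg_antitone_ge0 beta nonneg_antitone_lim).
destruct (ex_series_bounded beta (u 1%nat) beta_ge0) as [beta_summable sum_le].
{ intros n; rewrite <- partial_sum_S; apply partial_sum_le_full. }
split; [easy|split; [easy|]]; intros k.
set (X := fun m => mul_prod beta m (exp_coef (u 1%nat - partial_sum beta m)) k).
assert (X_u : is_lim_seq X (u k)).
{ set (bound := u 1%nat ^ 2 * shift (shift (exp_coef (u 1%nat))) k).
  apply is_lim_seq_incr_1.
  apply is_lim_seq_le_le with (fun _ => u k) (fun m => u k + bound * / INR (S m)).
  - intros m; assert (S_gt0 : 0 < INR (S m)) by (apply lt_0_INR; lia).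
    destruct (head_exp_tail_bounds_lim (S m) k) as [gap_ge0 gap_le].
    fold bound (X (S m)) in gap_le, gap_ge0; split; [lra|].
    apply (Rmult_le_compat_r (/ INR (S m))) in gap_le;
      [|left; now apply Rinv_0_lt_compat].
    replace (INR (S m) * (X (S m) - u k) * / INR (S m)) with (X (S m) - u k) in gap_le
      by (field; lra); lra.
  - apply is_lim_seq_const.
  - replace (Finite (u k)) with (Finite (u k + bound * 0)) by (f_equal; ring).
    apply is_lim_seq_plus'; [apply is_lim_seq_const|].
    apply is_lim_seq_mult'; [apply is_lim_seq_const|apply is_lim_seq_inv_S]. }
assert (X_laguerre : is_lim_seq X (laguerre_coef beta (u 1%nat - Series beta) k)).
{ eapply is_lim_seq_ext; [|apply is_lim_seq_mul_prod_exp_tail; auto; lra].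
  intros m; unfold X; do 2 f_equal; ring. }
apply is_lim_seq_unique in X_u; apply is_lim_seq_unique in X_laguerre; congruence.
Qed.

End PointwiseLimit.

Lemma mul_prod_lim_is_laguerre_coef (B : nat -> nat -> R) (N : nat -> nat) (u : nat -> R) :
  (forall n, nonneg_antitone (B n)) -> (forall n j, (N n <= j)%nat -> B n j = 0) ->
  (forall k, is_lim_seq (fun n => mul_prod (B n) (N n) one_coef k) (u k)) ->
  exists alpha beta, 0 <= alpha /\ nonneg_antitone beta /\ ex_series beta /\
    forall k, u k = laguerre_coef beta alpha k.
Proof.
intros B_na B_zero_tail prod_u.
destruct (filterlim_bounded (fun n => partial_sum (B n) (N n))) as [s s_bound].
{ exists (u 1%nat); now apply is_lim_seq_full_sum. }
destruct (diagonal_extraction B (fun _ => 0) (fun _ => s)) as [phi [beta [phi_oo B_beta]]].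
{ intros n j; assert (Bn_ge0 := nonneg_antitone_ge0 _ (B_na n)); split; [auto|].
  apply Rle_trans with (partial_sum (B n) (N n)).
  2:{ eapply Rle_trans; [apply Rle_abs|apply s_bound]. }
  destruct (Nat.le_gt_cases (N n) j) as [N_j|j_N].
  { rewrite B_zero_tail by easy; now apply partial_sum_ge0. }
  replace (N n) with (S j + (N n - S j))%nat by lia; rewrite partial_sum_add; simpl.
  assert (head := partial_sum_ge0 (B n) Bn_ge0 j).
  assert (tail := partial_sum_ge0 (fun i => B n (S j + i)%nat) (fun i => Bn_ge0 _) (N n - S j)).
  simpl in tail; lra. }
destruct (mul_prod_lim_eq_laguerre_coef (fun n => B (phi n)) (fun n => N (phi n)) u beta)
  as [beta_summable [sum_le u_eq]]; auto.
{ intros k; exact (is_lim_seq_subseq _ _ phi phi_oo (prod_u k)). }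
exists (u 1%nat - Series beta), beta; repeat split; auto; try lra.
all: now apply (nonneg_antitone_lim (fun n => B (phi n))).
Qed.

Definition laguerre_polya (w : nat -> R) : Prop :=
  exists c l alpha beta, 0 <= c /\ 0 <= alpha /\ nonneg_antitone beta /\ ex_series beta /\
    forall k, w k = c * Nat.iter l shift (laguerre_coef beta alpha) k.

Lemma laguerre_polya_0 : laguerre_polya (fun _ => 0).
Proof.
exists 0, O, 0, (fun _ => 0); split; [lra|split; [lra|split; [intros j; lra|split]]].
- apply (ex_series_bounded (fun _ => 0) 0); [intros; lra|].
  intros n; rewrite sum_n_const; lra.
- intros k; ring.
Qed.

Lemma laguerre_polya_approx w : laguerre_polya w ->
  exists V : nat -> nat -> R, (forall n, nonpos_rooted (V n)) /\
    (forall n k, 0 <= V n k <= w k) /\ forall k, is_lim_seq (fun n => V n k) (w k).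
Proof.
intros [c [l [alpha [beta [c_ge0 [alpha_ge0 [beta_na [beta_summable w_eq]]]]]]]].
assert (beta_ge0 := nonneg_antitone_ge0 beta beta_na).
exists (fun n k => c * Nat.iter l shift (laguerre_approx beta alpha n) k).
split; [|split; intros; rewrite w_eq].
- intros n; now apply NonposRooted.scal_closed, nonpos_rooted_iter_shift, laguerre_approx_rooted.
- destruct (Nat.le_gt_cases l k) as [l_k|k_l]; [|rewrite !iter_shift_lt by easy; lra].
  replace k with (l + (k - l))%nat by lia; rewrite !iter_shift_add.
  destruct (laguerre_approx_le beta beta_ge0 beta_summable alpha alpha_ge0 n (k - l)).
  split; [now apply Rmult_le_pos|now apply Rmult_le_compat_l].
- apply is_lim_seq_mult'; [apply is_lim_seq_const|].
  destruct (Nat.le_gt_cases l k) as [l_k|k_l].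
  + replace k with (l + (k - l))%nat by lia; rewrite iter_shift_add.
    apply is_lim_seq_ext with (fun n => laguerre_approx beta alpha n (k - l)).
    { intros n; now rewrite iter_shift_add. }
    now apply is_lim_seq_laguerre_approx.
  + rewrite iter_shift_lt by easy; apply is_lim_seq_ext with (fun _ => 0).
    { intros n; now rewrite iter_shift_lt. }
    apply is_lim_seq_const.
Qed.

Lemma laguerre_polya_lim_of_order (g : nat -> nat -> R) (w : nat -> R) l :
  (forall n, nonpos_rooted (g n)) -> (forall n, g n l <> 0) ->
  (forall n k, (k < l)%nat -> g n k = 0) ->
  (forall k, is_lim_seq (fun n => g n k) (w k)) -> 0 < w l -> laguerre_polya w.
Proof.
intros g_rooted gl_neq0 g_low g_w wl_gt0.
assert (w_low : forall k, (k < l)%nat -> w k = 0).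
{ intros k k_l; assert (gk_cv := is_lim_seq_unique _ _ (g_w k)).
  rewrite (Lim_seq_ext _ (fun _ => 0)), Lim_seq_const in gk_cv by (intros n; auto).
  now injection gk_cv. }
destruct (functional_choice (fun n (p : (nat -> R) * nat) => nonneg_antitone (fst p) /\
    (forall j, (snd p <= j)%nat -> fst p j = 0) /\
    forall k, mul_prod (fst p) (snd p) one_coef k = g n (l + k)%nat / g n l)) as [p pP].
{ intros n; destruct (nonpos_rooted_of_order (g n) l) as [beta [N betaP]]; auto.
  now exists (beta, N). }
destruct (mul_prod_lim_is_laguerre_coef (fun n => fst (p n)) (fun n => snd (p n))
    (fun k => w (l + k)%nat / w l)) as [alpha [beta [alpha_ge0 [beta_na [beta_summable w_eq]]]]].
{ intros n; apply pP. }
{ intros n; apply pP. }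
{ intros k; apply is_lim_seq_ext with (fun n => g n (l + k)%nat / g n l).
  - intros n; symmetry; apply pP.
  - apply is_lim_seq_div'; auto; lra. }
exists (w l), l, alpha, beta; split; [lra|]; do 3 (split; [easy|]); intros k.
destruct (Nat.le_gt_cases l k) as [l_k|k_l].
- replace k with (l + (k - l))%nat by lia; rewrite iter_shift_add, <- w_eq; field; lra.
- rewrite iter_shift_lt, w_low by easy; ring.
Qed.

Lemma laguerre_polya_lim (g : nat -> nat -> R) (w : nat -> R) :
  (forall n, nonpos_rooted (g n)) -> (forall n k, 0 <= g n k <= w k) ->
  (forall k, is_lim_seq (fun n => g n k) (w k)) -> laguerre_polya w.
Proof.
intros g_rooted g_bounds g_w.
destruct (classic (exists k, w k <> 0)) as [w_neq0|w_eq0].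
2:{ replace w with (fun _ : nat => 0); [exact laguerre_polya_0|].
  apply functional_extensionality; intros k; apply NNPP; intros wk; apply w_eq0; now exists k. }
destruct (least_nonzero_index w w_neq0) as [l [wl_neq0 w_low]].
assert (wl_gt0 : 0 < w l) by (destruct (g_bounds O l); lra).
destruct (is_lim_seq_close _ _ _ (g_w l) wl_gt0) as [n0 gl_close].
apply (laguerre_polya_lim_of_order (fun n => g (n + n0)%nat) w l); auto.
- intros n; specialize (gl_close (n + n0)%nat ltac:(lia)).
  apply Rabs_def2 in gl_close; lra.
- intros n k k_l; destruct (g_bounds (n + n0)%nat k); rewrite w_low in * by easy; lra.
- intros k; now apply (is_lim_seq_incr_n (fun n => g n k)).
Qed.

(** * Complex power series *)

Lemma filterlim_C_pair (u : nat -> C) (l : C) :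
  filterlim u eventually (locally l) <->
  is_lim_seq (fun n => fst (u n)) (fst l) /\ is_lim_seq (fun n => snd (u n)) (snd l).
Proof.
split.
- intros u_l; split.
  + apply (filterlim_comp _ _ _ u fst eventually (locally l) (locally (fst l)) u_l).
    intros P [d Pd]; exists d; intros y [fst_y _]; now apply Pd.
  + apply (filterlim_comp _ _ _ u snd eventually (locally l) (locally (snd l)) u_l).
    intros P [d Pd]; exists d; intros y [_ snd_y]; now apply Pd.
- intros [fst_l snd_l] P [d Pd].
  destruct (fst_l _ (locally_ball (fst l) d)) as [N1 fst_ball].
  destruct (snd_l _ (locally_ball (snd l) d)) as [N2 snd_ball].
  exists (max N1 N2); intros n n_ge; apply Pd; split; [apply fst_ball|apply snd_ball]; lia.
Qed.

Lemma sum_n_C_pair (a : nat -> C) n :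
  sum_n a n = (sum_n (fun k => fst (a k)) n, sum_n (fun k => snd (a k)) n).
Proof.
induction n as [|n IHn]; [now rewrite !sum_O, <- surjective_pairing|].
now rewrite !sum_Sn, IHn.
Qed.

Lemma is_series_C_pair (a : nat -> C) (l : C) :
  is_series a l <->
  is_series (fun k => fst (a k)) (fst l) /\ is_series (fun k => snd (a k)) (snd l).
Proof.
unfold is_series at 1; rewrite filterlim_C_pair.
split; intros [fst_l snd_l]; split.
- eapply filterlim_ext; [|exact fst_l]; intros n; exact (f_equal fst (sum_n_C_pair a n)).
- eapply filterlim_ext; [|exact snd_l]; intros n; exact (f_equal snd (sum_n_C_pair a n)).
- eapply is_lim_seq_ext; [|exact fst_l]; intros n; exact (eq_sym (f_equal fst (sum_n_C_pair a n))).
- eapply is_lim_seq_ext; [|exact snd_l]; intros n; exact (eq_sym (f_equal snd (sum_n_C_pair a n))).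
Qed.

Lemma CSeries_correct (a : nat -> C) : ex_series a -> is_series a (CSeries a).
Proof.
intros [l a_l]; apply is_series_C_pair in a_l; destruct a_l as [fst_l snd_l].
apply is_series_C_pair; split; apply Series_correct; eexists; eassumption.
Qed.

Lemma is_series_C_unique (a : nat -> C) (l1 l2 : C) : is_series a l1 -> is_series a l2 -> l1 = l2.
Proof. exact (filterlim_locally_unique (V := C_NormedModule) (F := eventually) _ l1 l2). Qed.

Lemma CSeries_unique (a : nat -> C) (l : C) : is_series a l -> CSeries a = l.
Proof.
intros a_l; apply (is_series_C_unique a); [|easy]; apply CSeries_correct; now exists l.
Qed.

Lemma is_series_RtoC (a : nat -> R) (l : R) :
  is_series a l -> is_series (fun k => RtoC (a k)) (RtoC l).
Proof.
intros a_l; apply is_series_C_pair; split; [exact a_l|exact is_series_zero].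
Qed.

Lemma ex_series_Cmod (a : nat -> C) : ex_series (fun k => Cmod (a k)) -> ex_series a.
Proof. exact (ex_series_le (V := C_CompleteNormedModule) a _ (fun k => Rle_refl _)). Qed.

Lemma is_series_Cmod_le (a : nat -> C) l (M : nat -> R) m :
  is_series a l -> is_series M m -> (forall k, Cmod (a k) <= M k) -> Cmod l <= m.
Proof.
intros a_l M_m a_le.
apply (filterlim_le (F := eventually) (fun n => Cmod (sum_n a n)) (sum_n M)
  (Finite (Cmod l)) (Finite m)).
- apply filter_forall; intros n; induction n as [|n IHn]; [now rewrite !sum_O|].
  rewrite !sum_Sn; eapply Rle_trans; [apply Cmod_triangle|now apply Rplus_le_compat].
- eapply filterlim_comp; [exact a_l|]; apply (filterlim_norm (V := C_NormedModule)).
- exact M_m.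
Qed.

Definition is_Cpseries (u : coefs) (z l : C) : Prop := is_series (fun k => (u k * z ^ k)%C) l.

Lemma is_Cpseries_ext u v z l : (forall k, u k = v k) -> is_Cpseries u z l -> is_Cpseries v z l.
Proof. intros uv; now rewrite (functional_extensionality _ _ uv). Qed.

Lemma is_Cpseries_scal c u z l :
  is_Cpseries u z l -> is_Cpseries (fun k => (c * u k)%C) z (c * l)%C.
Proof.
intros u_l; apply (is_series_scal c) in u_l; unfold is_Cpseries.
eapply is_series_ext; [|exact u_l]; intros k; exact (Cmult_assoc c (u k) (z ^ k)%C).
Qed.

Lemma is_Cpseries_plus u v z l m : is_Cpseries u z l -> is_Cpseries v z m ->
  is_Cpseries (fun k => (u k + v k)%C) z (l + m)%C.
Proof.
intros u_l v_m; unfold is_Cpseries.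
eapply is_series_ext; [|exact (is_series_plus _ _ _ _ u_l v_m)].
intros k; exact (eq_sym (Cmult_plus_distr_r (u k) (v k) (z ^ k)%C)).
Qed.

Lemma is_Cpseries_shift h z l :
  is_Cpseries (fun k => RtoC (h k)) z l -> is_Cpseries (fun k => RtoC (shift h k)) z (z * l)%C.
Proof.
intros h_l; apply is_series_decr_1.
change (is_series (fun k => RtoC (h k) * (z * z ^ k))%C (z * l + - (RtoC 0 * RtoC 1))%C).
replace (z * l + - (RtoC 0 * RtoC 1))%C with (z * l)%C by ring.
eapply is_series_ext; [|exact (is_series_scal z _ l h_l)]; intros k.
change (z * (RtoC (h k) * z ^ k) = RtoC (h k) * (z * z ^ k))%C; ring.
Qed.

Lemma is_Cpseries_mul_linear p q h z l : is_Cpseries (fun k => RtoC (h k)) z l ->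
  is_Cpseries (fun k => RtoC (mul_linear p q h k)) z ((RtoC p + RtoC q * z) * l)%C.
Proof.
intros h_l; replace ((RtoC p + RtoC q * z) * l)%C
  with (RtoC p * l + RtoC q * (z * l))%C by ring.
apply is_Cpseries_ext with (fun k => RtoC p * RtoC (h k) + RtoC q * RtoC (shift h k))%C.
{ intros k; unfold mul_linear; now rewrite RtoC_plus, !RtoC_mult. }
apply is_Cpseries_plus; apply is_Cpseries_scal; [easy|now apply is_Cpseries_shift].
Qed.

Lemma is_Cpseries_mul_prod beta n h z l : is_Cpseries (fun k => RtoC (h k)) z l ->
  is_Cpseries (fun k => RtoC (mul_prod beta n h k)) z (partial_prod beta z n * l)%C.
Proof.
revert h l; induction n as [|n IHn]; intros h l h_l; simpl.
- now rewrite Cmult_1_l.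
- rewrite <- Cmult_assoc; now apply IHn, is_Cpseries_mul_linear.
Qed.

Lemma is_Cpseries_iter_shift h z l m : is_Cpseries (fun k => RtoC (h k)) z l ->
  is_Cpseries (fun k => RtoC (Nat.iter m shift h k)) z (z ^ m * l)%C.
Proof.
intros h_l; induction m as [|m IHm]; simpl; [now rewrite Cmult_1_l|].
rewrite <- Cmult_assoc; now apply is_Cpseries_shift.
Qed.

Lemma is_series_exp_coef s r : is_series (fun k => exp_coef s k * r ^ k) (exp (s * r)).
Proof.
eapply is_series_ext; [|exact (proj1 (is_pseries_R _ _ _) (is_exp_Reals (s * r)))].
intros k; unfold exp_coef; rewrite Rpow_mult_distr; simpl; field; apply INR_fact_neq_0.
Qed.

Lemma Cmod_Cpseries_le (u : coefs) (z : C) (M : nat -> R) k :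
  Cmod (u k) <= M k -> Cmod (u k * z ^ k)%C <= M k * Cmod z ^ k.
Proof.
intros u_le; rewrite Cmod_mult, Cmod_pow; apply Rmult_le_compat_r; [|easy].
apply pow_le, Cmod_ge_0.
Qed.

Definition exp_bounded (M b : R) (u : coefs) : Prop := forall k, Cmod (u k) <= M * exp_coef b k.

Lemma ex_Cpseries_exp_bounded u M b z : exp_bounded M b u -> exists l, is_Cpseries u z l.
Proof.
intros u_le; apply (ex_series_le (V := C_CompleteNormedModule) _
  (fun k => M * (exp_coef b k * Cmod z ^ k))).
- intros k; rewrite <- Rmult_assoc.
  now apply (Cmod_Cpseries_le u z (fun k => M * exp_coef b k)).
- exists (M * exp (b * Cmod z)); exact (is_series_scal M _ _ (is_series_exp_coef b (Cmod z))).
Qed.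

Lemma ex_Cpseries_exp_coef s z : 0 <= s -> exists l, is_Cpseries (fun k => RtoC (exp_coef s k)) z l.
Proof.
intros s_ge0; apply ex_Cpseries_exp_bounded with 1 s; intros k.
rewrite Cmod_R, Rabs_right; [lra|now apply Rle_ge, exp_coef_ge0].
Qed.

Lemma is_Cpseries_dominated_lim (a : nat -> nat -> R) (b : nat -> R) s z (A : nat -> C) :
  (forall n k, 0 <= a n k <= exp_coef s k) ->
  (forall k, is_lim_seq (fun n => a n k) (b k)) ->
  (forall n, is_Cpseries (fun k => RtoC (a n k)) z (A n)) ->
  exists l, is_Cpseries (fun k => RtoC (b k)) z l /\ filterlim A eventually (locally l).
Proof.
intros a_bounds a_b a_A; set (M := fun k => exp_coef s k * Cmod z ^ k).
set (term := fun (h : nat -> R) k => (RtoC (h k) * z ^ k)%C).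
assert (coordinate_cv : forall coord : C -> R,
  (forall x w, coord (RtoC x * w)%C = x * coord w) -> (forall w, Rabs (coord w) <= Cmod w) ->
  is_lim_seq (fun n => Series (fun k => coord (term (a n) k)))
    (Series (fun k => coord (term b k)))).
{ intros coord coord_scal coord_le; apply is_lim_seq_Series_dominated with M.
  - eexists; apply is_series_exp_coef.
  - intros n k; eapply Rle_trans; [apply coord_le|].
    apply (Cmod_Cpseries_le (fun i => RtoC (a n i))).
    rewrite Cmod_R, Rabs_right; [|apply Rle_ge]; apply a_bounds.
  - intros k; unfold term; rewrite coord_scal.
    apply is_lim_seq_ext with (fun n => a n k * coord (z ^ k)%C).
    { intros n; now rewrite coord_scal. }
    apply is_lim_seq_mult'; [auto|apply is_lim_seq_const]. }
assert (b_le : exp_bounded 1 s (fun k => RtoC (b k))).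
{ intros k; rewrite Cmod_R, Rmult_1_l.
  apply (is_lim_seq_le (fun n => Rabs (a n k)) (fun _ => exp_coef s k)
    (Finite (Rabs (b k))) (Finite (exp_coef s k))).
  - intros n; rewrite Rabs_right; [|apply Rle_ge]; apply a_bounds.
  - exact (is_lim_seq_abs _ _ (a_b k)).
  - apply is_lim_seq_const. }
assert (b_l := CSeries_correct _ (ex_Cpseries_exp_bounded _ 1 s z b_le)).
exists (CSeries (term b)); split; [exact b_l|].
apply filterlim_C_pair; split.
- apply is_lim_seq_ext with (fun n => Series (fun k => fst (term (a n) k))).
  { intros n; apply is_series_unique, (proj1 (is_series_C_pair _ _) (a_A n)). }
  apply coordinate_cv; [intros; simpl; ring|].
  intros w; eapply Rle_trans; [apply Rmax_l|apply Rmax_Cmod].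
- apply is_lim_seq_ext with (fun n => Series (fun k => snd (term (a n) k))).
  { intros n; apply is_series_unique, (proj1 (is_series_C_pair _ _) (a_A n)). }
  apply coordinate_cv; [intros; simpl; ring|].
  intros w; eapply Rle_trans; [apply Rmax_r|apply Rmax_Cmod].
Qed.

Lemma is_Cpseries_one_coef z : is_Cpseries (fun k => RtoC (one_coef k)) z (RtoC 1).
Proof.
apply is_series_decr_1.
change (is_series (fun k => RtoC 0 * (z * z ^ k))%C (RtoC 1 + - (RtoC 1 * RtoC 1))%C).
replace (RtoC 1 + - (RtoC 1 * RtoC 1))%C with (RtoC 0) by ring.
eapply is_series_ext; [|exact (is_series_zero (V := C_NormedModule))].
intros k; exact (eq_sym (Cmult_0_l _)).
Qed.

Lemma filterlim_Cmult_r (u : nat -> C) (l c : C) :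
  filterlim u eventually (locally l) ->
  filterlim (fun n => u n * c)%C eventually (locally (l * c)%C).
Proof.
intros u_l; rewrite Cmult_comm.
apply filterlim_ext with (fun n => scal c (u n)); [intros n; exact (Cmult_comm c (u n))|].
exact (filterlim_comp _ _ _ u (scal c) _ _ _ u_l (filterlim_scal_r (V := C_NormedModule) c l)).
Qed.

Lemma is_Cpseries_laguerre_coef beta alpha z :
  (forall j, 0 <= beta j) -> ex_series beta -> 0 <= alpha ->
  exists E P, is_Cpseries (fun k => RtoC (exp_coef alpha k)) z E /\
    filterlim (partial_prod beta z) eventually (locally P) /\
    is_Cpseries (fun k => RtoC (laguerre_coef beta alpha k)) z (E * P)%C.
Proof.
intros beta_ge0 beta_summable alpha_ge0.
assert (product_cv : forall s E, 0 <= s -> is_Cpseries (fun k => RtoC (exp_coef s k)) z E ->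
  exists V, is_Cpseries (fun k => RtoC (laguerre_coef beta s k)) z V /\
    filterlim (fun n => partial_prod beta z n * E)%C eventually (locally V)).
{ intros s E s_ge0 exp_E.
  apply (is_Cpseries_dominated_lim (fun n => mul_prod beta n (exp_coef s)) _ (s + Series beta)).
  - intros n k; split; [|now apply mul_prod_exp_coef_le_Series].
    apply mul_prod_ge0; auto; intros i; now apply exp_coef_ge0.
  - intros k; now apply is_lim_seq_laguerre_coef.
  - intros n; now apply is_Cpseries_mul_prod. }
destruct (product_cv 0 (RtoC 1)) as [P [_ prod_P]];
  [lra|rewrite exp_coef_0; apply is_Cpseries_one_coef|].
destruct (ex_Cpseries_exp_coef alpha z alpha_ge0) as [E exp_E].
destruct (product_cv alpha E) as [V [laguerre_V prod_V]]; auto.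
apply (filterlim_ext _ (partial_prod beta z)) in prod_P; [|intros n; apply Cmult_1_r].
exists E, P; split; [easy|split; [easy|]]; rewrite Cmult_comm.
replace (P * E)%C with V; [easy|].
exact (filterlim_locally_unique (V := C_NormedModule) _ _ _ prod_V
  (filterlim_Cmult_r _ _ E prod_P)).
Qed.

Lemma pseries_coef_eq_0 (d : nat -> R) :
  (forall x, is_series (fun k => d k * x ^ k) 0) -> forall k, d k = 0.
Proof.
intros d_0 k; apply (PSeries_ext_recip d (fun _ => 0)).
- apply Rbar_not_le_lt; intros radius_le; apply (CV_disk_outside d 1).
  + eapply Rbar_le_lt_trans; [exact radius_le|]; rewrite Rabs_R1; simpl; lra.
  + apply ex_series_lim_0; eexists; apply d_0.
- rewrite CV_radius_const_0; exact I.
- apply filter_forall; intros x; rewrite PSeries_const_0; apply is_series_unique, d_0.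
Qed.

Lemma Cpseries_coef_unique (u v : coefs) :
  (forall x : R, exists l, is_Cpseries u (RtoC x) l /\ is_Cpseries v (RtoC x) l) ->
  forall k, u k = v k.
Proof.
intros u_v k.
assert (diff_0 : forall x : R,
  is_series (fun i => (u i + RtoC (-1) * v i) * RtoC x ^ i)%C (RtoC 0)).
{ intros x; destruct (u_v x) as [l [u_l v_l]].
  replace (RtoC 0) with (l + RtoC (-1) * l)%C by ring.
  apply (is_Cpseries_plus u); [easy|now apply is_Cpseries_scal]. }
assert (diff_pair : forall x : R, is_series (fun i => fst (u i + RtoC (-1) * v i)%C * x ^ i) 0 /\
  is_series (fun i => snd (u i + RtoC (-1) * v i)%C * x ^ i) 0).
{ intros x; destruct (proj1 (is_series_C_pair _ _) (diff_0 x)) as [fst_0 snd_0]; split.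
  - eapply is_series_ext; [|exact fst_0]; intros i; simpl; rewrite <- RtoC_pow; simpl; ring.
  - eapply is_series_ext; [|exact snd_0]; intros i; simpl; rewrite <- RtoC_pow; simpl; ring. }
assert (fst_eq := pseries_coef_eq_0 _ (fun x => proj1 (diff_pair x)) k).
assert (snd_eq := pseries_coef_eq_0 _ (fun x => proj2 (diff_pair x)) k).
simpl in fst_eq, snd_eq; apply injective_projections; lra.
Qed.

Lemma exp_coef_Cpow s (z : C) k :
  (RtoC (exp_coef s k) * z ^ k)%C = ((RtoC s * z) ^ k * RtoC (/ INR (fact k)))%C.
Proof. unfold exp_coef, Rdiv; rewrite Cpow_mult_l, RtoC_mult, RtoC_pow; ring. Qed.

Lemma in_Lplus_laguerre_polya (u : coefs) : in_Lplus u ->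
  exists (c : C) (w : nat -> R),
    c <> RtoC 0 /\ laguerre_polya w /\ forall k, u k = (c * RtoC (w k))%C.
Proof.
intros [_ [c [l [alpha [beta [alpha_ge0 [beta_na [beta_ge0 [beta_summable u_series]]]]]]]]].
assert (u_eq : forall k, u k = (c * RtoC (Nat.iter l shift (laguerre_coef beta alpha) k))%C).
2:{ destruct (Ceq_dec c (RtoC 0)) as [c_eq0|c_neq0].
  - exists (RtoC 1), (fun _ => 0); split; [exact C1_nz|split; [exact laguerre_polya_0|]].
    intros k; rewrite u_eq, c_eq0; ring.
  - exists c, (Nat.iter l shift (laguerre_coef beta alpha)); split; [easy|split; [|easy]].
    exists 1, l, alpha, beta; do 4 (split; [easy || lra|]); intros k; ring. }
apply Cpseries_coef_unique; intros x.
destruct (u_series (RtoC x)) as [E [P [exp_E [prod_P u_EP]]]].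
destruct (is_Cpseries_laguerre_coef beta alpha (RtoC x))
  as [E' [P' [exp_E' [prod_P' laguerre_EP]]]]; auto.
replace E' with E in laguerre_EP.
2:{ apply (is_series_C_unique _ _ _ exp_E).
  eapply is_series_ext; [|exact exp_E']; intros k; apply exp_coef_Cpow. }
replace P' with P in laguerre_EP.
2:{ exact (filterlim_locally_unique (V := C_NormedModule) _ _ _ prod_P prod_P'). }
eexists; split; [exact u_EP|].
replace (c * RtoC x ^ l * E * P)%C with (c * (RtoC x ^ l * (E * P)))%C by ring.
now apply is_Cpseries_scal, is_Cpseries_iter_shift.
Qed.

Lemma laguerre_polya_in_Lplus (c : C) (w : nat -> R) :
  laguerre_polya w -> in_Lplus (fun k => c * RtoC (w k))%C.
Proof.
intros [d [l [alpha [beta [d_ge0 [alpha_ge0 [beta_na [beta_summable w_eq]]]]]]]].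
assert (beta_ge0 := nonneg_antitone_ge0 beta beta_na).
assert (w_series : forall z, exists E P, is_Cpseries (fun k => RtoC (exp_coef alpha k)) z E /\
  filterlim (partial_prod beta z) eventually (locally P) /\
  is_Cpseries (fun k => c * RtoC (w k))%C z (c * RtoC d * z ^ l * E * P)%C).
{ intros z; destruct (is_Cpseries_laguerre_coef beta alpha z)
    as [E [P [exp_E [prod_P laguerre_EP]]]]; auto.
  exists E, P; split; [easy|split; [easy|]].
  replace (c * RtoC d * z ^ l * E * P)%C with ((c * RtoC d) * (z ^ l * (E * P)))%C by ring.
  apply is_Cpseries_ext with
    (fun k => (c * RtoC d) * RtoC (Nat.iter l shift (laguerre_coef beta alpha) k))%C.
  { intros k; rewrite w_eq, RtoC_mult; ring. }
  now apply is_Cpseries_scal, is_Cpseries_iter_shift. }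
split.
{ intros z; destruct (w_series z) as [E [P [_ [_ w_EP]]]]; eexists; exact w_EP. }
exists (c * RtoC d)%C, l, alpha, beta; do 4 (split; [easy|]); intros z.
destruct (w_series z) as [E [P [exp_E [prod_P w_EP]]]].
exists E, P; split; [|split; [easy|exact w_EP]].
eapply is_series_ext; [|exact exp_E]; intros k; apply exp_coef_Cpow.
Qed.

(** * Norm estimates *)

Lemma exp_bounded_ge0 M b u : exp_bounded M b u -> 0 <= M.
Proof.
intros u_le; specialize (u_le O); unfold exp_coef in u_le; simpl in u_le.
assert (u_ge0 := Cmod_ge_0 (u O)); lra.
Qed.

Lemma exp_bounded_plus M N b u v :
  exp_bounded M b u -> exp_bounded N b v -> exp_bounded (M + N) b (fun k => u k + v k)%C.
Proof.
intros u_le v_le k; specialize (u_le k); specialize (v_le k).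
assert (triangle := Cmod_triangle (u k) (v k)); lra.
Qed.

Lemma normb_le_iff b u (M : R) : 0 < b -> Rbar_le (normb b u) M <-> exp_bounded M b u.
Proof.
intros b_gt0; unfold normb.
destruct (Lub_Rbar_correct (fun r => exists k : nat, r = / (b ^ k) * Cmod (deriv0 u k)))
  as [upper least].
assert (quotient_le_iff : forall k,
  / b ^ k * Cmod (deriv0 u k) <= M <-> Cmod (u k) <= M * exp_coef b k).
{ intros k; assert (pow_gt0 := pow_lt b k b_gt0); assert (fact_gt0 := INR_fact_lt_0 k).
  unfold deriv0; rewrite Cmod_mult, Cmod_R, Rabs_right by lra.
  replace (/ b ^ k * (INR (fact k) * Cmod (u k))) with (Cmod (u k) / exp_coef b k)
    by (unfold exp_coef; field; lra).
  assert (exp_gt0 : 0 < exp_coef b k) by now apply Rdiv_lt_0_compat.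
  split; intros u_le; [apply Rle_div_l in u_le|apply Rle_div_l]; lra. }
split.
- intros norm_le k; apply quotient_le_iff.
  exact (Rbar_le_trans (Finite _) _ _ (upper _ (ex_intro _ k eq_refl)) norm_le).
- intros u_le; apply least; intros x [k ->]; apply quotient_le_iff, u_le.
Qed.

Lemma normb_ge0 b u : Rbar_le 0 (normb b u).
Proof.
destruct (Lub_Rbar_correct (fun r => exists k : nat, r = / (b ^ k) * Cmod (deriv0 u k)))
  as [upper _].
apply Rbar_le_trans with (Finite (/ b ^ 0 * Cmod (deriv0 u 0))).
- simpl; rewrite Rinv_1, Rmult_1_l; apply Cmod_ge_0.
- apply upper; now exists O.
Qed.

Lemma in_A_iff a u : 0 <= a -> in_A a u <-> forall b, a < b -> exists M, exp_bounded M b u.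
Proof.
intros a_ge0; split.
- intros [_ norm_finite] b a_b; exists (real (normb b u)); apply normb_le_iff; [lra|].
  rewrite norm_finite by easy; apply Rbar_le_refl.
- intros bounded; split.
  + intros z; destruct (bounded (a + 1)) as [M u_le]; [lra|].
    now apply (ex_Cpseries_exp_bounded u M (a + 1)).
  + intros b a_b; destruct (bounded b a_b) as [M u_le].
    apply normb_le_iff in u_le; [|lra]; assert (norm_ge0 := normb_ge0 b u).
    now destruct (normb b u).
Qed.

Fixpoint rising (p : R) (k : nat) : R :=
  match k with O => 1 | S j => p * rising (p + 1) j end.

Lemma rising_S p k : rising p (S k) = (p + INR k) * rising p k.
Proof.
revert p; induction k as [|k IHk]; intros p; [simpl; ring|].
change (rising p (S (S k))) with (p * rising (p + 1) (S k)); rewrite IHk, S_INR; simpl; ring.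
Qed.

Lemma rising_ge0 p k : 0 <= p -> 0 <= rising p k.
Proof.
revert p; induction k as [|k IHk]; intros p p_ge0; simpl; [lra|].
apply Rmult_le_pos; [easy|apply IHk; lra].
Qed.

Lemma rising_le p q k : 0 <= p <= q -> rising p k <= rising q k.
Proof.
revert p q; induction k as [|k IHk]; intros p q p_q; simpl; [lra|].
apply Rmult_le_compat; [lra|apply rising_ge0; lra|lra|apply IHk; lra].
Qed.

Definition negbin_term (x p : R) (k : nat) : R := x ^ k * (rising p k / INR (fact k)).

Lemma negbin_term_ge0 x p k : 0 <= x -> 0 <= p -> 0 <= negbin_term x p k.
Proof.
intros x_ge0 p_ge0; apply Rmult_le_pos; [now apply pow_le|].
apply Rdiv_le_0_compat; [now apply rising_ge0|apply INR_fact_lt_0].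
Qed.

Lemma negbin_telescope x p n :
  (1 - x) * sum_n (negbin_term x (p + 1)) n =
  sum_n (negbin_term x p) n - x * negbin_term x (p + 1) n.
Proof.
induction n as [|n IHn]; [rewrite !sum_O; unfold negbin_term; simpl; field|].
rewrite !sum_n_S, Rmult_plus_distr_l, IHn.
assert (pascal : negbin_term x (p + 1) (S n) = negbin_term x p (S n) + x * negbin_term x (p + 1) n).
{ unfold negbin_term; rewrite (rising_S (p + 1)).
  change (rising p (S n)) with (p * rising (p + 1) n).
  rewrite INR_fact_S; assert (fact_gt0 := INR_fact_lt_0 n); assert (n_ge0 := pos_INR n).
  simpl; field; lra. }
rewrite pascal; ring.
Qed.

Lemma negbin_sum_le x m n : 0 <= x < 1 -> sum_n (negbin_term x (INR m)) n <= (/ (1 - x)) ^ m.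
Proof.
intros x_bounds; induction m as [|m IHm].
- right; induction n as [|n IHn]; [rewrite sum_O; unfold negbin_term; simpl; field|].
  rewrite sum_n_S, IHn; unfold negbin_term, Rdiv; simpl; ring.
- assert (telescope := negbin_telescope x (INR m) n).
  assert (boundary_ge0 : 0 <= x * negbin_term x (INR m + 1) n).
  { apply Rmult_le_pos; [easy|]; apply negbin_term_ge0; [easy|]; assert (m_ge0 := pos_INR m); lra. }
  rewrite S_INR; simpl pow; apply (Rmult_le_reg_l (1 - x)); [lra|].
  rewrite <- Rmult_assoc, Rinv_r, Rmult_1_l by lra; lra.
Qed.

Lemma negbin_series x p m : 0 <= x < 1 -> 0 <= p <= INR m ->
  ex_series (negbin_term x p) /\ Series (negbin_term x p) <= (/ (1 - x)) ^ m.
Proof.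
intros x_bounds p_bounds; apply ex_series_bounded.
- intros k; now apply negbin_term_ge0.
- intros n; eapply Rle_trans; [|now apply (negbin_sum_le x m n)].
  rewrite !sum_n_Reals; apply sum_Rle; intros k _; apply Rmult_le_compat_l; [now apply pow_le|].
  apply Rmult_le_compat_r; [left; apply Rinv_0_lt_compat, INR_fact_lt_0|now apply rising_le].
Qed.

Lemma dcoef_S theta k n :
  dcoef theta (S k) (n + S k) = (INR n + 1) * (INR n + theta) * dcoef theta k (S n + k).
Proof.
replace (n + S k)%nat with (S n + k)%nat by lia.
change (dcoef theta (S k) (S n + k)) with
  (dcoef theta k (S n + k) * INR (S n + k - k) * (INR (S n + k - k) - 1 + theta)).
replace (S n + k - k)%nat with (S n) by lia; rewrite S_INR; ring.
Qed.

Lemma dcoef_rising theta k n :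
  dcoef theta k (n + k) = INR (fact (n + k)) / INR (fact n) * rising (INR n + theta) k.
Proof.
revert n; induction k as [|k IHk]; intros n.
- rewrite Nat.add_0_r; simpl; field; apply INR_fact_neq_0.
- rewrite dcoef_S, IHk, INR_fact_S, S_INR; simpl rising.
  replace (n + S k)%nat with (S n + k)%nat by lia.
  replace (INR n + 1 + theta) with (INR n + theta + 1) by ring.
  assert (fact_gt0 := INR_fact_lt_0 n); assert (n_ge0 := pos_INR n); field; lra.
Qed.

Lemma dcoef_ge0 theta k n : 0 <= theta -> 0 <= dcoef theta k (n + k).
Proof.
intros theta_ge0; rewrite dcoef_rising; apply Rmult_le_pos.
- apply Rdiv_le_0_compat; [apply pos_INR|apply INR_fact_lt_0].
- apply rising_ge0; assert (n_ge0 := pos_INR n); lra.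
Qed.

Section NormEstimate.

Variables (theta b1 b2 M N : R) (phi f : coefs).
Hypotheses (theta_ge0 : 0 <= theta) (b1_ge0 : 0 <= b1) (b2_ge0 : 0 <= b2)
  (b1b2_lt1 : b1 * b2 < 1) (phi_bounded : exp_bounded M b1 phi) (f_bounded : exp_bounded N b2 f).

Lemma Dop_term_Cmod_le n k :
  Cmod (Dop_term theta phi f n k) <=
  M * N * exp_coef b2 n * negbin_term (b1 * b2) (INR n + theta) k.
Proof.
assert (dcoef_pos := dcoef_ge0 theta k n theta_ge0).
unfold Dop_term; rewrite !Cmod_mult, Cmod_R, Rabs_right by lra.
replace (M * N * exp_coef b2 n * negbin_term (b1 * b2) (INR n + theta) k)
  with (M * exp_coef b1 k * (N * exp_coef b2 (n + k)) * dcoef theta k (n + k)).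
- apply Rmult_le_compat_r; [easy|].
  apply Rmult_le_compat; auto using Cmod_ge_0.
- rewrite dcoef_rising; unfold exp_coef, negbin_term; rewrite Rpow_mult_distr, pow_add.
  field; auto using INR_fact_neq_0.
Qed.

Lemma Dop_term_ex_series_Cmod n : ex_series (fun k => Cmod (Dop_term theta phi f n k)).
Proof.
destruct (INR_unbounded (INR n + theta)) as [m m_gt].
destruct (negbin_series (b1 * b2) (INR n + theta) m) as [summable _].
{ split; [now apply Rmult_le_pos|easy]. }
{ assert (n_ge0 := pos_INR n); lra. }
apply (ex_series_le (V := R_CompleteNormedModule) _
  (fun k => M * N * exp_coef b2 n * negbin_term (b1 * b2) (INR n + theta) k)).
- intros k; unfold norm; simpl; unfold abs; simpl.
  rewrite Rabs_right by (apply Rle_ge, Cmod_ge_0); apply Dop_term_Cmod_le.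
- now apply (ex_series_scal_l (K := R_AbsRing) (V := R_NormedModule)).
Qed.

Lemma Dop_term_ex_series n : ex_series (Dop_term theta phi f n).
Proof. apply ex_series_Cmod, Dop_term_ex_series_Cmod. Qed.

Lemma Dop_exp_bounded m b3 : theta <= INR m -> b2 <= b3 * (1 - b1 * b2) ->
  exp_bounded (M * N * (/ (1 - b1 * b2)) ^ m) b3 (Dop theta phi f).
Proof.
intros theta_m b3_ge n; set (y := / (1 - b1 * b2)).
assert (M_ge0 := exp_bounded_ge0 _ _ _ phi_bounded).
assert (N_ge0 := exp_bounded_ge0 _ _ _ f_bounded).
assert (y_gt0 : 0 < y) by (apply Rinv_0_lt_compat; lra).
destruct (negbin_series (b1 * b2) (INR n + theta) (n + m)) as [summable sum_le].
{ split; [now apply Rmult_le_pos|easy]. }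
{ rewrite plus_INR; assert (n_ge0 := pos_INR n); lra. }
apply Rle_trans with (M * N * exp_coef b2 n * Series (negbin_term (b1 * b2) (INR n + theta))).
{ exact (is_series_Cmod_le _ _ _ _ (CSeries_correct _ (Dop_term_ex_series n))
    (is_series_scal_l _ _ _ (Series_correct _ summable)) (Dop_term_Cmod_le n)). }
assert (coef_ge0 : 0 <= M * N * exp_coef b2 n).
{ apply Rmult_le_pos; [now apply Rmult_le_pos|now apply exp_coef_ge0]. }
apply Rle_trans with (M * N * exp_coef b2 n * y ^ (n + m)); [now apply Rmult_le_compat_l|].
replace (M * N * exp_coef b2 n * y ^ (n + m)) with (M * N * y ^ m * exp_coef (b2 * y) n)
  by (unfold exp_coef; rewrite Rpow_mult_distr, pow_add; unfold Rdiv; ring).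
apply Rmult_le_compat_l; [apply Rmult_le_pos; [now apply Rmult_le_pos|apply pow_le; lra]|].
apply exp_coef_le; split; [apply Rmult_le_pos; lra|].
apply Rle_div_l; lra.
Qed.

End NormEstimate.

Lemma Dop_sub theta (phi f phi0 f0 : coefs) n :
  ex_series (Dop_term theta (csub phi phi0) f n) ->
  ex_series (Dop_term theta phi0 (csub f f0) n) ->
  ex_series (Dop_term theta phi0 f0 n) ->
  csub (Dop theta phi f) (Dop theta phi0 f0) n =
  (Dop theta (csub phi phi0) f n + Dop theta phi0 (csub f f0) n)%C.
Proof.
intros phi_part f_part base.
assert (total := is_series_plus _ _ _ _ (is_series_plus _ _ _ _ (CSeries_correct _ phi_part)
  (CSeries_correct _ f_part)) (CSeries_correct _ base)).
apply (is_series_ext _ (Dop_term theta phi f n)) in total.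
- assert (Dop_eq : Dop theta phi f n = (Dop theta (csub phi phi0) f n +
    Dop theta phi0 (csub f f0) n + Dop theta phi0 f0 n)%C) by exact (CSeries_unique _ _ total).
  unfold csub at 1; rewrite Dop_eq; ring.
- intros k; change (Dop_term theta (csub phi phi0) f n k + Dop_term theta phi0 (csub f f0) n k +
    Dop_term theta phi0 f0 n k = Dop_term theta phi f n k)%C; unfold Dop_term, csub; ring.
Qed.

Lemma Dop_sub_exp_bounded theta b1 b2 b3 M N delta m (phi f phi0 f0 : coefs) :
  0 <= theta <= INR m -> 0 <= b1 -> 0 <= b2 -> b1 * b2 < 1 -> b2 <= b3 * (1 - b1 * b2) ->
  exp_bounded M b1 phi0 -> exp_bounded N b2 f0 ->
  exp_bounded delta b1 (csub phi phi0) -> exp_bounded delta b2 (csub f f0) ->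
  exp_bounded (delta * (M + N + delta) * (/ (1 - b1 * b2)) ^ m) b3
    (csub (Dop theta phi f) (Dop theta phi0 f0)).
Proof.
intros [theta_ge0 theta_m] b1_ge0 b2_ge0 b1b2_lt1 b3_ge phi0_le f0_le phi_close f_close.
assert (f_le : exp_bounded (N + delta) b2 f).
{ replace f with (fun k => f0 k + csub f f0 k)%C; [now apply exp_bounded_plus|].
  apply functional_extensionality; intros k; unfold csub; ring. }
replace (csub (Dop theta phi f) (Dop theta phi0 f0)) with
  (fun n => Dop theta (csub phi phi0) f n + Dop theta phi0 (csub f f0) n)%C.
2:{ apply functional_extensionality; intros n; symmetry; apply Dop_sub.
  - now apply (Dop_term_ex_series theta b1 b2 delta (N + delta)).
  - now apply (Dop_term_ex_series theta b1 b2 M delta).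
  - now apply (Dop_term_ex_series theta b1 b2 M N). }
replace (delta * (M + N + delta) * (/ (1 - b1 * b2)) ^ m)
  with (delta * (N + delta) * (/ (1 - b1 * b2)) ^ m + M * delta * (/ (1 - b1 * b2)) ^ m) by ring.
apply exp_bounded_plus; now apply Dop_exp_bounded.
Qed.

Lemma radii_exist a b b3 : 0 <= a -> 0 <= b -> a * b < 1 -> b / (1 - a * b) < b3 ->
  exists b1 b2, a < b1 /\ b < b2 /\ b1 * b2 < 1 /\ b2 <= b3 * (1 - b1 * b2).
Proof.
intros a_ge0 b_ge0 ab_lt1 b3_gt.
assert (gap_gt0 : b < b3 * (1 - a * b)) by (apply Rlt_div_l in b3_gt; lra).
assert (b3_gt0 : 0 < b3) by nra.
set (gap := b3 * (1 - a * b) - b); set (slope := 1 + b3 * (a + b + 1)).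
assert (slope_gt0 : 0 < slope) by (unfold slope; nra).
set (e := Rmin 1 (gap / slope)).
assert (e_gt0 : 0 < e) by (apply Rmin_glb_lt; [lra|apply Rdiv_lt_0_compat; unfold gap; lra]).
assert (e_le1 : e <= 1) by apply Rmin_l.
assert (e_slope : e * slope <= gap) by (apply Rle_div_r; [lra|apply Rmin_r]).
assert (b2_le : b + e <= b3 * (1 - (a + e) * (b + e))).
{ assert (curvature : 0 <= e * b3 * (1 - e)) by (repeat apply Rmult_le_pos; lra).
  unfold gap, slope in e_slope; lra. }
exists (a + e), (b + e); repeat split; try lra; nra.
Qed.

(** * The operator on the Laguerre-Polya class *)

Definition real_Dop_term (theta : R) (phi f : nat -> R) (n k : nat) : R :=
  phi k * f (n + k)%nat * dcoef theta k (n + k).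

Definition real_Dop (theta : R) (phi f : nat -> R) (n : nat) : R :=
  Series (real_Dop_term theta phi f n).

Lemma real_Dop_term_ex_series theta phi f n :
  nonpos_rooted phi -> ex_series (real_Dop_term theta phi f n).
Proof.
intros phi_rooted; destruct (nonpos_rooted_finite_support phi phi_rooted) as [m phi_0].
apply ex_series_finite_support with m; intros k k_ge.
unfold real_Dop_term; rewrite phi_0 by easy; ring.
Qed.

Lemma real_Dop_term_shift_0 theta phi f n : real_Dop_term theta (shift phi) f n 0 = 0.
Proof. unfold real_Dop_term; simpl; ring. Qed.

Lemma real_Dop_term_shift_S theta phi f n k :
  real_Dop_term theta (shift phi) f n (S k) =
  (INR n + 1) * (INR n + theta) * real_Dop_term theta phi f (S n) k.
Proof.
unfold real_Dop_term; rewrite dcoef_S; replace (n + S k)%nat with (S n + k)%nat by lia; simpl; ring.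
Qed.

Lemma real_Dop_const theta c f n : real_Dop theta (fun k => c * one_coef k) f n = c * f n.
Proof.
unfold real_Dop; rewrite Series_incr_1 by (apply real_Dop_term_ex_series; constructor).
rewrite (Series_ext _ (fun _ => 0 * 0)) by (intros k; unfold real_Dop_term; simpl; ring).
rewrite Series_scal_l; unfold real_Dop_term; simpl; rewrite Nat.add_0_r; ring.
Qed.

Lemma real_Dop_mul_linear theta p q phi f n : nonpos_rooted phi ->
  real_Dop theta (mul_linear p q phi) f n =
  p * real_Dop theta phi f n + q * delta_coef theta (real_Dop theta phi f) n.
Proof.
intros phi_rooted; set (c := (INR n + 1) * (INR n + theta)).
assert (shift_series : is_series (real_Dop_term theta (shift phi) f n)
                         (c * real_Dop theta phi f (S n))).
{ apply is_series_decr_1.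
  change (is_series (fun k => real_Dop_term theta (shift phi) f n (S k))
    (c * real_Dop theta phi f (S n) + - real_Dop_term theta (shift phi) f n 0)).
  rewrite real_Dop_term_shift_0, Ropp_0, Rplus_0_r.
  eapply is_series_ext; [intros k; symmetry; apply real_Dop_term_shift_S|].
  apply (is_series_scal_l c _ (real_Dop theta phi f (S n))), Series_correct.
  now apply real_Dop_term_ex_series. }
unfold delta_coef; fold c; apply is_series_unique.
eapply is_series_ext; [|exact (is_series_plus _ _ _ _
  (is_series_scal_l p _ _ (Series_correct _ (real_Dop_term_ex_series theta phi f n phi_rooted)))
  (is_series_scal_l q _ _ shift_series))].
intros k; change (p * real_Dop_term theta phi f n k + q * real_Dop_term theta (shift phi) f n k =
  real_Dop_term theta (mul_linear p q phi) f n k); unfold real_Dop_term, mul_linear; ring.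
Qed.

Lemma nonpos_rooted_real_Dop theta phi f :
  0 <= theta -> nonpos_rooted phi -> nonpos_rooted f -> nonpos_rooted (real_Dop theta phi f).
Proof.
intros theta_ge0 phi_rooted f_rooted; induction phi_rooted as [c|p q h p_ge0 q_ge0 h_rooted IHh].
- apply nonpos_rooted_ext with (fun n => c * f n); [intros n; symmetry; apply real_Dop_const|].
  now apply NonposRooted.scal_closed.
- eapply nonpos_rooted_ext; [intros n; symmetry; now apply real_Dop_mul_linear|].
  now apply NonposRooted.delta_closed.
Qed.

Lemma laguerre_polya_real_Dop theta v w : 0 <= theta -> laguerre_polya v -> laguerre_polya w ->
  (forall n, ex_series (real_Dop_term theta v w n)) -> laguerre_polya (real_Dop theta v w).
Proof.
intros theta_ge0 v_lp w_lp summable.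
destruct (laguerre_polya_approx v v_lp) as [V [V_rooted [V_bounds V_v]]].
destruct (laguerre_polya_approx w w_lp) as [W [W_rooted [W_bounds W_w]]].
assert (term_bounds : forall m n k,
  0 <= real_Dop_term theta (V m) (W m) n k <= real_Dop_term theta v w n k).
{ intros m n k; unfold real_Dop_term; assert (dcoef_pos := dcoef_ge0 theta k n theta_ge0).
  destruct (V_bounds m k); destruct (W_bounds m (n + k)%nat); split.
  - apply Rmult_le_pos; [now apply Rmult_le_pos|easy].
  - apply Rmult_le_compat_r; [easy|now apply Rmult_le_compat]. }
apply laguerre_polya_lim with (fun m => real_Dop theta (V m) (W m)).
- intros m; now apply nonpos_rooted_real_Dop.
- intros m n; split; [|now apply Series_le].
  replace 0 with (Series (fun _ : nat => 0)) by exact (is_series_unique _ _ is_series_zero).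
  apply Series_le; [|now apply real_Dop_term_ex_series].
  intros k; split; [lra|apply term_bounds].
- intros n; apply is_lim_seq_Series_dominated with (real_Dop_term theta v w n); auto.
  + intros m k; rewrite Rabs_right; [|apply Rle_ge]; apply term_bounds.
  + intros k; unfold real_Dop_term; apply is_lim_seq_mult'; [|apply is_lim_seq_const].
    now apply is_lim_seq_mult'.
Qed.

Lemma in_Lplus_Dop theta phi f : 0 <= theta -> in_Lplus phi -> in_Lplus f ->
  (forall n, ex_series (fun k => Cmod (Dop_term theta phi f n k))) -> in_Lplus (Dop theta phi f).
Proof.
intros theta_ge0 phi_Lplus f_Lplus abs_summable.
destruct (in_Lplus_laguerre_polya phi phi_Lplus) as [c [v [c_neq0 [v_lp phi_eq]]]].
destruct (in_Lplus_laguerre_polya f f_Lplus) as [d [w [d_neq0 [w_lp f_eq]]]].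
assert (term_eq : forall n k,
  Dop_term theta phi f n k = (c * d * RtoC (real_Dop_term theta v w n k))%C).
{ intros n k; unfold Dop_term, real_Dop_term; rewrite phi_eq, f_eq, !RtoC_mult; ring. }
assert (cd_gt0 : 0 < Cmod (c * d)) by now apply Cmod_gt_0, Cmult_neq_0.
assert (summable : forall n, ex_series (real_Dop_term theta v w n)).
{ intros n; apply (ex_series_le (V := R_CompleteNormedModule) _
    (fun k => / Cmod (c * d) * Cmod (Dop_term theta phi f n k))).
  - intros k; rewrite term_eq, (Cmod_mult (c * d)), Cmod_R.
    rewrite <- Rmult_assoc, Rinv_l, Rmult_1_l by lra; apply Rle_refl.
  - exact (ex_series_scal_l (K := R_AbsRing) (V := R_NormedModule) _ _ (abs_summable n)). }
replace (Dop theta phi f) with (fun n => c * d * RtoC (real_Dop theta v w n))%C.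
- apply laguerre_polya_in_Lplus; now apply laguerre_polya_real_Dop.
- apply functional_extensionality; intros n.
  assert (Dop_series : is_series (Dop_term theta phi f n) (c * d * RtoC (real_Dop theta v w n))%C).
  { eapply is_series_ext; [intros k; symmetry; apply term_eq|].
    exact (is_series_scal (c * d)%C _ _ (is_series_RtoC _ _ (Series_correct _ (summable n)))). }
  exact (eq_sym (CSeries_unique _ _ Dop_series)).
Qed.

Section Continuity.

Variables (theta a b : R).
Hypotheses (theta_ge0 : 0 <= theta) (a_ge0 : 0 <= a) (b_ge0 : 0 <= b) (ab_lt1 : a * b < 1).

Local Notation c := (b / (1 - a * b)).

Lemma in_A_exp_bounded_radii phi f b3 : in_A a phi -> in_A b f -> c < b3 ->
  exists b1 b2 M N, a < b1 /\ b < b2 /\ b1 * b2 < 1 /\ b2 <= b3 * (1 - b1 * b2) /\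
    exp_bounded M b1 phi /\ exp_bounded N b2 f.
Proof.
intros phi_A f_A b3_gt.
destruct (radii_exist a b b3 a_ge0 b_ge0 ab_lt1 b3_gt) as [b1 [b2 [b1_gt [b2_gt radii]]]].
destruct (proj1 (in_A_iff a phi a_ge0) phi_A b1 b1_gt) as [M phi_le].
destruct (proj1 (in_A_iff b f b_ge0) f_A b2 b2_gt) as [N f_le].
now exists b1, b2, M, N.
Qed.

Lemma in_A_Dop phi f : in_A a phi -> in_A b f -> in_A c (Dop theta phi f).
Proof.
intros phi_A f_A; apply in_A_iff.
{ apply Rdiv_le_0_compat; lra. }
intros b3 b3_gt; destruct (in_A_exp_bounded_radii phi f b3 phi_A f_A b3_gt)
  as [b1 [b2 [M [N [b1_gt [b2_gt [b1b2_lt1 [b3_ge [phi_le f_le]]]]]]]]].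
destruct (INR_unbounded theta) as [m theta_m].
exists (M * N * (/ (1 - b1 * b2)) ^ m); apply Dop_exp_bounded; auto; lra.
Qed.

Lemma in_A_Dop_term_ex_series_Cmod phi f n : in_A a phi -> in_A b f ->
  ex_series (fun k => Cmod (Dop_term theta phi f n k)).
Proof.
intros phi_A f_A; destruct (in_A_exp_bounded_radii phi f (c + 1) phi_A f_A ltac:(lra))
  as [b1 [b2 [M [N [b1_gt [b2_gt [b1b2_lt1 [_ [phi_le f_le]]]]]]]]].
apply (Dop_term_ex_series_Cmod theta b1 b2 M N); auto; lra.
Qed.

Lemma in_Lplus_a_Dop phi f :
  in_Lplus_a a phi -> in_Lplus_a b f -> in_Lplus_a c (Dop theta phi f).
Proof.
intros [phi_Lplus phi_A] [f_Lplus f_A]; split; [|now apply in_A_Dop].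
apply in_Lplus_Dop; auto; intros n; now apply in_A_Dop_term_ex_series_Cmod.
Qed.

Lemma Dop_continuous phi0 f0 b3 eps : in_A a phi0 -> in_A b f0 -> c < b3 -> 0 < eps ->
  exists b1 b2 delta, a < b1 /\ b < b2 /\ 0 < delta /\
    forall phi f : coefs, Rbar_lt (normb b1 (csub phi phi0)) delta ->
      Rbar_lt (normb b2 (csub f f0)) delta ->
      Rbar_lt (normb b3 (csub (Dop theta phi f) (Dop theta phi0 f0))) eps.
Proof.
intros phi0_A f0_A b3_gt eps_gt0.
destruct (in_A_exp_bounded_radii phi0 f0 b3 phi0_A f0_A b3_gt)
  as [b1 [b2 [M [N [b1_gt [b2_gt [b1b2_lt1 [b3_ge [phi0_le f0_le]]]]]]]]].
destruct (INR_unbounded theta) as [m theta_m].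
assert (M_ge0 := exp_bounded_ge0 _ _ _ phi0_le); assert (N_ge0 := exp_bounded_ge0 _ _ _ f0_le).
assert (b3_gt0 : 0 < b3) by (assert (0 < b3 * (1 - b1 * b2)) by lra; nra).
set (L := (/ (1 - b1 * b2)) ^ m).
assert (L_gt0 : 0 < L) by (apply pow_lt, Rinv_0_lt_compat; lra).
set (K := (M + N + 1) * L); assert (K_gt0 : 0 < K) by (apply Rmult_lt_0_compat; lra).
set (delta := Rmin 1 (eps / 2 / K)).
assert (delta_gt0 : 0 < delta) by (apply Rmin_glb_lt; [|apply Rdiv_lt_0_compat]; lra).
assert (delta_le1 : delta <= 1) by apply Rmin_l.
assert (delta_K : delta * K <= eps / 2) by (apply Rle_div_r; [lra|apply Rmin_r]).
exists b1, b2, delta; split; [easy|split; [easy|split; [easy|]]].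
intros phi f phi_close f_close.
apply Rbar_lt_le, normb_le_iff in phi_close, f_close; [|lra..].
apply Rbar_le_lt_trans with (Finite (delta * (M + N + delta) * L)).
- apply normb_le_iff; [easy|]; apply Dop_sub_exp_bounded; auto; lra.
- simpl; apply Rle_lt_trans with (delta * K); [|lra].
  rewrite Rmult_assoc; apply Rmult_le_compat_l; [lra|].
  apply Rmult_le_compat_r; lra.
Qed.

End Continuity.

Theorem theorem1p3 (theta a b : R) :
  0 <= theta -> 0 <= a -> 0 <= b -> a * b < 1 ->
  let c := b / (1 - a * b) in
  (forall phi f : coefs, in_Lplus_a a phi -> in_Lplus_a b f ->
     (forall n : nat, ex_series (Dop_term theta phi f n)) /\
     in_Lplus_a c (Dop theta phi f))
  /\
  (forall phi0 f0 : coefs, in_Lplus_a a phi0 -> in_Lplus_a b f0 ->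
     forall (b3 eps : R), c < b3 -> 0 < eps ->
     exists (b1 b2 delta : R), a < b1 /\ b < b2 /\ 0 < delta /\
       forall phi f : coefs, in_Lplus_a a phi -> in_Lplus_a b f ->
         Rbar_lt (normb b1 (csub phi phi0)) (Finite delta) ->
         Rbar_lt (normb b2 (csub f f0)) (Finite delta) ->
         Rbar_lt (normb b3 (csub (Dop theta phi f) (Dop theta phi0 f0))) (Finite eps)).
Proof.
intros theta_ge0 a_ge0 b_ge0 ab_lt1 c; split.
- intros phi f phi_La f_Lb; split; [|now apply in_Lplus_a_Dop].
  intros n; apply ex_series_Cmod.
  apply (in_A_Dop_term_ex_series_Cmod theta a b); auto; [apply phi_La|apply f_Lb].
- intros phi0 f0 [_ phi0_A] [_ f0_A] b3 eps b3_gt eps_gt0.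
  destruct (Dop_continuous theta a b theta_ge0 a_ge0 b_ge0 ab_lt1 phi0 f0 b3 eps)
    as [b1 [b2 [delta [b1_gt [b2_gt [delta_gt0 close]]]]]]; auto.
  exists b1, b2, delta; repeat split; auto.
Qed.
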